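(* Let $(Z_{ij})_{(i,j)\in N_n}$ be directed dyadic data $Z_{ij}=F(\mu_i,\mu_j,\varepsilon_{ij})$, with common marginal law $P$. For every $p>1$ and $a,b\ge1$, $$\Big\|\sup_{f\in\mathcal F}\mathbb G_n(f)\Big\|_{L^1}\lesssim\sqrt n\,\gamma_{2,a}\big(\mathcal F,\|\cdot\|_{L^{2p}(P)}\big)+\frac{1}{\sqrt n}\,\gamma_{1,b}\big(\mathcal F,\|\cdot\|_\infty\big),$$ where $\lesssim$ means inequality up to a universal multiplicative constant.
   Context: For $n\ge2$ let $[n]=\{1,\dots,n\}$ and $N_n=\{(i,j):i,j\in[n],\ i\ne j\}$, so $|N_n|=n(n-1)$. $(\mu_i)_{i\in[n]}$ and $(\varepsilon_{ij})_{(i,j)\in N_n}$ are mutually independent collections of IID random variables, $F$ is a measurable function with values in a Polish space $\mathsf Z$, and $Z_{ij}=F(\mu_i,\mu_j,\varepsilon_{ij})$; $P$ is the common law of the $Z_{ij}$. The associated dependency graph on $N_n$ joins two distinct dyads whenever they share an endpoint. $\mathcal F\ni0$ is a class of real-valued measurable functions on $\mathsf Z$, and the empirical process is normalized by the number of observations (dyads): $$\mathbb G_n(f)=|N_n|^{-1/2}\sum_{(i,j)\in N_n}\{f(Z_{ij})-\mathbb E[f(Z_{ij})]\}.$$ The $L^1$ norm is with respect to the underlying probability. Talagrand complexity. For $s>0$, an admissible partition sequence of order $s$ for $\mathcal F$ is a sequence $T^\infty=(T_l)_{l\ge0}$ of partitions of $\mathcal F$ that is increasing (each $T_{l+1}$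 refines $T_l$) with $\operatorname{card}(T_0)=1$ and $\operatorname{card}(T_l)\le2^{2^{l/s}}$ for $l\ge1$. $T(f,T_l)$ is the element of $T_l$ containing $f$, and $D(f,T_l)(z)=\sup_{f_1,f_2\in T(f,T_l)}|f_1(z)-f_2(z)|$. For $q>0$ and a norm $\mathbf d$ (here $\|\cdot\|_{L^{2p}(P)}$ or $\|\cdot\|_\infty$), $\gamma_{q,s}(\mathcal F,\mathbf d)=\inf_{T^\infty}\sup_{f\in\mathcal F}\sum_{l=0}^\infty2^{l/q}\,\mathbf d(D(f,T_l))$, the infimum being over admissible partition sequences of order $s$. *)

(* Defs.v *)
From HB Require Import structures.
From mathcomp Require Import all_boot all_order all_algebra.
From mathcomp Require Import all_classical all_reals all_analysis.
From mathcomp Require Import measurable_realfun.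

Set Implicit Arguments.
Unset Strict Implicit.
Unset Printing Implicit Defensive.

Import Order.TTheory GRing.Theory Num.Theory.
Import numFieldNormedType.Exports.

Local Open Scope classical_set_scope.
Local Open Scope ring_scope.

Notation borel S := (g_sigma_algebraType (@open S)).

(* The ball structure carried by a [completePseudoMetricType] is complete;
   being Hausdorff makes the pseudometric a metric. *)
Definition polish_space (R : realType) (S : completePseudoMetricType R) :=
  hausdorff_space S /\ exists2 D : set S, countable D & dense D.

Notation dyad n := {ij : 'I_n * 'I_n | ij.1 != ij.2}.

Lemma card_dyad (n : nat) : #|{: dyad n}| = (n * n.-1)%N.
Proof.
rewrite card_sig; have := cardC [pred ij : 'I_n * 'I_n | ij.1 != ij.2].
have -> : #|[predC [pred ij : 'I_n * 'I_n | ij.1 != ij.2]]| = n.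
  have inj : injective (fun i : 'I_n => (i, i)) by move=> i j [].
  rewrite -[RHS](card_ord n) -(fintype.card_image inj).
  apply: eq_card => -[i j]; rewrite !inE /= negbK.
  by apply/eqP/fintype.imageP => [->|[k _ [-> ->]]//]; exists j.
by rewrite card_prod card_ord -subn1 mulnBr muln1 => <-; rewrite addnK.
Qed.

Section probability_notions.
Local Open Scope ereal_scope.
Context d (T : measurableType d) (R : realType).

Definition mutually_independent (Pr : probability T R) (I : finType)
    (G : I -> set (set T)) :=
  forall (J : {set I}) (A : I -> set T), (forall i, i \in J -> G i (A i)) ->
    Pr (\bigcap_(i in [set` J]) A i) = \prod_(i in J) Pr (A i).

Definition identically_distributed (Pr : probability T R) (I : Type)
    d' (U : measurableType d') (X : I -> {mfun T >-> U}) :=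
  forall (i j : I) (A : set U), measurable A ->
    distribution Pr (X i) A = distribution Pr (X j) A.

(* L^q norm of a possibly non-measurable function, through its measurable
   majorants (outer integral); suprema over uncountable classes need not be
   measurable. *)
Definition outer_Lnorm (mu : {measure set T -> \bar R}) (q : \bar R)
    (h : T -> \bar R) : \bar R :=
  ereal_inf [set 'N[mu]_q[g] | g in
    [set g : T -> \bar R | measurable_fun setT g /\ forall x, `|h x| <= g x]].

Lemma outer_LnormE (mu : {measure set T -> \bar R}) (q : R)
    (h : T -> \bar R) : (0 < q)%R -> measurable_fun setT h ->
  outer_Lnorm mu q%:E h = 'N[mu]_q%:E[h].
Proof.
move=> q0 mh; apply/eqP; rewrite eq_le; apply/andP; split.
  rewrite -(Lnorm_abse mu h); apply: ereal_inf_lbound.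
  by exists (abse \o h) => //; split => //; exact: measurableT_comp.
apply: le_ereal_inf_tmp => _ [g [mg hg] <-].
have itv01 (y : \bar R) : 0 <= y -> y \in `[0, +oo].
  by move=> y0; rewrite in_itv/= y0 leey.
rewrite unlock /Lnorm; apply: gt0_ler_poweR; rewrite ?invr_ge0 ?(ltW q0)//.
- by apply: itv01; apply: integral_ge0 => x _; exact: poweR_ge0.
- by apply: itv01; apply: integral_ge0 => x _; exact: poweR_ge0.
apply: ge0_le_integral => //.
- by move=> *; exact: poweR_ge0.
- by apply: (measurableT_comp (measurable_poweR _)); exact: measurableT_comp.
- by apply: (measurableT_comp (measurable_poweR _)); exact: measurableT_comp.
- move=> x _; apply: gt0_ler_poweR; rewrite ?(ltW q0) ?itv01//.
  by rewrite (le_trans (hg x))// lee_abs.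
Qed.

End probability_notions.

Section dyadic.
Context (R : realType) (n : nat).
Context dO (Omega : measurableType dO) dM (M : measurableType dM).
Context dE (E : measurableType dE) dZ (Z : measurableType dZ).
Variable Pr : probability Omega R.
Variables (mu : 'I_n -> {mfun Omega >-> M}) (eps : dyad n -> {mfun Omega >-> E}).

(* The whole family (mu_i)_i, (eps_ij)_ij is mutually independent, expressed on
   the sigma-algebras generated by the variables since mu and eps take values
   in different spaces. *)
Definition iid_inputs : Prop :=
  [/\ identically_distributed Pr mu, identically_distributed Pr eps &
      mutually_independent Pr (fun k : 'I_n + dyad n =>
        match k with
        | inl i => preimage_set_system setT (mu i) measurable
        | inr ij => preimage_set_system setT (eps ij) measurable
        end)].

Definition dyadic_data (F : M * M * E -> Z) (ij : dyad n) (w : Omega) : Z :=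
  F (mu (val ij).1 w, mu (val ij).2 w, eps ij w).

End dyadic.

(* For non-integrable f (Z_ij) the centering term is a junk value, harmlessly: the
   L^(2p) complexity of any class containing 0 and such an f is +oo. *)
Definition empirical_process (R : realType) (n : nat)
    dO (Omega : measurableType dO) (Pr : probability Omega R) (Z : Type)
    (X : dyad n -> Omega -> Z) (f : Z -> R) (w : Omega) : R :=
  (Num.sqrt #|{: dyad n}|%:R)^-1 *
  \sum_(ij : dyad n) (f (X ij w) - fine 'E_Pr[f \o X ij]).

Section talagrand.
Context (R : realType) (Z : Type).
Implicit Types (Fc : set (Z -> R)) (T : nat -> set (set (Z -> R))).

Definition admissible (s : R) Fc T : Prop :=
  [/\ forall l, partition (T l) id Fc,
      forall l A, T l.+1 A -> exists2 B, T l B & A `<=` B,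
      (T 0%N #= `I_1)%card &
      forall l, (1 <= l)%N -> exists2 m : nat,
        (T l #= `I_m)%card & m%:R <= 2 `^ (2 `^ (l%:R / s)) :> R].

(* [pblock Tl id f] is the element of the partition [Tl] containing f. *)
Definition block_width (f : Z -> R) (Tl : set (set (Z -> R))) (z : Z) : \bar R :=
  ereal_sup [set `|fs.1 z - fs.2 z|%:E |
    fs in pblock Tl id f `*` pblock Tl id f].

Definition gamma_complexity (q s : R) Fc (nm : (Z -> \bar R) -> \bar R)
    : \bar R :=
  ereal_inf [set
    ereal_sup [set (\sum_(0 <= l <oo)
      (2 `^ (l%:R / q))%:E * nm (block_width f (T l)))%E | f in Fc]
    | T in admissible s Fc].

Definition sup_norm (h : Z -> \bar R) : \bar R :=
  ereal_sup [set `|h z|%E | z in setT].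

End talagrand.

(* Main.v *)
Require Import Defs.
From HB Require Import structures.
From mathcomp Require Import all_boot all_order all_algebra.
From mathcomp Require Import all_classical all_reals all_analysis.
From mathcomp Require Import measurable_realfun.
From mathcomp Require Import ring lra.

(* Dyads with pairwise disjoint endpoints carry independent observations, and
   the n (n - 1) dyads split into 2 n such matchings.  Jensen's inequality over
   the matchings turns the Bernstein bound for independent sums into a bound
   for the exponential moments of the whole dyadic sum.  The latter drives a
   generic chaining in which every function is truncated along its chain as
   soon as the width of its block exceeds
   [sqrt n * s_l * 2 ^ (- l / 2)], where [s_l] is the L^(2p) norm of that width,
   as in Ossiander's bracketing theorem.  The L^(2p) complexity then controls
   everything; the complexity for the supremum norm is only used, through its
   finiteness, to make the class uniformly bounded.  Chains of length n suffice,
   because the truncation level at depth n is already negligible. *)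

Set Implicit Arguments.
Unset Strict Implicit.
Unset Printing Implicit Defensive.

Import Order.TTheory GRing.Theory Num.Theory.
Import numFieldNormedType.Exports.

Local Open Scope classical_set_scope.
Local Open Scope ring_scope.

(** * Independence along matchings *)

Section independence.
Context d (T : measurableType d) (R : realType) (Pr : probability T R).
Local Open Scope ereal_scope.

(** A matching has at most [n] dyads, so the mean of the sums over the [2 n] matchings is controlled
    like a sum of only [n] independent terms. A function of L^2 norm [s] thus has a dyadic sum of
    order [n * sqrt n * s], and dividing by the square root of [n (n - 1)] leaves the factor
    [sqrt n]. The truncation level is forced from both sides. At exponent scale [2 ^ l], Bernstein's
    bound stays Gaussian only for functions below a multiple of [sqrt n * s_l * 2 ^ (- l / 2)]. What
    is cut off above a level [t] has mean at most [s_l ^ 2 / t]; at this level, summing over the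
    dyads gives again [n * sqrt n * 2 ^ (l / 2) * s_l], one term of the complexity series. The
    supremum over an uncountable class need not be measurable. Hence no tail probability is
    integrated: [y <= exp y] bounds every deviation pointwise, and the exponentials of the finitely
    many chain links add up to one measurable majorant, free of [f]. *)

Lemma indep_generated d' (U : measurableType d') (G : set (set U))
    (V : T -> U) (H : set T) :
  measurable = <<s G >> -> setI_closed G -> G setT ->
  measurable_fun setT V -> measurable H ->
  (forall A, G A -> Pr (V @^-1` A `&` H) = Pr (V @^-1` A) * Pr H) ->
  forall A, measurable A -> Pr (V @^-1` A `&` H) = Pr (V @^-1` A) * Pr H.
Proof.
move=> GE GI GT mV mH HG A mA.
have p0 : (0 <= fine (Pr H))%R by exact: fine_ge0.
have mVpre B : measurable B -> measurable (V @^-1` B).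
  by move=> mB; rewrite -[X in measurable X]setTI; exact: mV.
(* Both sides are finite measures in [A]: the push-forward of [Pr] restricted to [H], and the
   push-forward of [Pr] scaled by [Pr H]. Agreement on a generating pi-system makes them equal. *)
pose m1' : {measure set U -> \bar R} := pushforward (mrestr Pr mH) V.
pose m1 := m1' mV.
pose m2' : {measure set U -> \bar R} := pushforward Pr V.
pose m2 : {measure set U -> \bar R} := mscale (NngNum p0) (m2' mV).
have E2 B : m2 B = Pr (V @^-1` B) * Pr H.
  by rewrite /m2 /= /mscale/= fineK ?fin_num_measure// muleC.
rewrite -E2; apply: (@measure_unique _ _ _ G (fun=> setT) _ _ _ _ m1 m2) => //.
- by apply/seteqP; split => // x _; exists 0%N.
- by move=> B GB; rewrite E2; exact: HG.
- move=> _; apply: (@le_lt_trans _ _ (Pr setT)); last by rewrite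
  probability_setT ltry.
  apply: le_measure; rewrite ?inE//=; apply: measurableI => //.
  exact: mVpre.
Qed.

Lemma integral_prod_indep (X Y : T -> R) :
  measurable_fun setT X -> measurable_fun setT Y ->
  (forall A B, measurable A -> measurable B ->
    Pr (X @^-1` A `&` Y @^-1` B) = Pr (X @^-1` A) * Pr (Y @^-1` B)) ->
  (forall x, 0 <= X x)%R -> (forall x, 0 <= Y x)%R ->
  \int[Pr]_x (X x * Y x)%:E = (\int[Pr]_x (X x)%:E) * \int[Pr]_x (Y x)%:E.
Proof.
move=> mX mY XY X0 Y0.
pose X' : {mfun T >-> R} := HB.pack X (isMeasurableFun.Build _ _ _ _ X mX).
pose Y' : {mfun T >-> R} := HB.pack Y (isMeasurableFun.Build _ _ _ _ Y mY).
pose XY' : {mfun T >-> (R * R)%type} :=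
  HB.pack (fun x => (X x, Y x)) (isMeasurableFun.Build _ _ _ _ (fun x => (X x,
    Y x)) (measurable_fun_pair mX mY)).
pose f (z : R * R) := (`|z.1| * `|z.2|)%:E.
have f0 z : 0 <= f z by rewrite lee_fin mulr_ge0.
have mf : measurable_fun setT f.
  apply/measurable_EFinP; apply: measurable_funM; apply: measurableT_comp => //.
transitivity (\int[distribution Pr XY']_z f z).
  rewrite ge0_integral_distribution//.
  by apply: eq_integral => x _; rewrite /f /= !ger0_norm.
transitivity (\int[(distribution Pr X' \x distribution Pr Y')%E]_z f z).
  apply: eq_measure_integral => A mA _.
  exact/esym/product_measure_unique.
rewrite fubini_tonelli1//.
rewrite /fubini_F /f /=.
have mabs : measurable_fun setT (fun x : R => (`|x|%R)%:E).
  exact/measurable_EFinP.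
under eq_integral => x _.
  under eq_integral do rewrite EFinM.
  rewrite ge0_integralZl//.
  rewrite ge0_integral_distribution//.
  over.
rewrite ge0_integralZr//; last by apply: integral_ge0 => ? _ /=; rewrite lee_fin.
rewrite ge0_integral_distribution//.
by congr (_ * _); apply: eq_integral => x _ /=; rewrite ger0_norm.
Qed.

(** The coordinate projections are measurable for the sigma-algebra generated by boxes, hence so is
    the identity that they assemble. Boxes are the useful generators because an input triple lies in
    one exactly when each input satisfies a condition of its own. *)
Lemma measurable_prod3 d1 d2 d3 (T1 : measurableType d1) (T2 : measurableType d2)
    (T3 : measurableType d3) :
  @measurable _ (T1 * T2 * T3)%type =
  <<s [set A `*` BC.1 `*` BC.2 |
         A in measurable & BC in measurable `*` measurable] >>.
Proof.

set G := (X in <<s X >>).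
pose S := g_sigma_algebraType G.
have mG A B C : measurable A -> measurable B -> measurable C ->
    <<s G >> (A `*` B `*` C).
  by move=> mA mB mC; apply: sub_sigma_algebra; exists A => //; exists (B, C).
apply/seteqP; split; last first.
  apply: smallest_sub; first exact: sigma_algebra_measurable.
  by move=> _ [A mA] [[B C] [/= mB mC] <-]; do 2 apply: measurableX => //.
have m1 : measurable_fun setT (fun z : S => z.1.1).
  move=> _ A mA; rewrite setTI.
  rewrite (_ : _ @^-1` _ = A `*` setT `*` setT); first exact: mG.
  by apply/seteqP; split => [[[? ?] ?]//|[[? ?] ?] [[]]].
have m2 : measurable_fun setT (fun z : S => z.1.2).
  move=> _ A mA; rewrite setTI.
  rewrite (_ : _ @^-1` _ = setT `*` A `*` setT); first exact: mG.
  by apply/seteqP; split => [[[? ?] ?]//|[[? ?] ?] [[]]].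
have m3 : measurable_fun setT (fun z : S => z.2).
  move=> _ A mA; rewrite setTI.
  rewrite (_ : _ @^-1` _ = setT `*` setT `*` A); first exact: mG.
  by apply/seteqP; split => [[[? ?] ?]//|[[? ?] ?] []].
have := measurable_fun_pair (measurable_fun_pair m1 m2) m3.
move=> mid A mA; have := mid measurableT A mA; rewrite setTI.
by rewrite (_ : _ @^-1` A = A)//; apply/seteqP; split => [[[]]//|[[]]].
Qed.
End independence.

(** * Independence of observations with disjoint inputs *)

Section dyadic_independence.
Context d (T : measurableType d) (R : realType) (Pr : probability T R).
Context (n : nat) dM (M : measurableType dM) dE (E : measurableType dE).
Variables (mu : 'I_n -> {mfun T >-> M}) (eps : dyad n -> {mfun T >-> E}).
Hypothesis iid : iid_inputs Pr mu eps.
Local Open Scope ereal_scope.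

Let input_events (k : 'I_n + dyad n) : set (set T) :=
  match k with
  | inl i => preimage_set_system setT (mu i) measurable
  | inr ij => preimage_set_system setT (eps ij) measurable
  end.

Definition dyad_inputs (k : dyad n) : {set 'I_n + dyad n} :=
  [set inl (val k).1; inl (val k).2; inr k].

Definition matching (s : seq (dyad n)) :=
  pairwise (fun k l => [disjoint dyad_inputs k & dyad_inputs l]%B) s.

Definition input_triple (k : dyad n) (w : T) : M * M * E :=
  (mu (val k).1 w, mu (val k).2 w, eps k w).

Lemma measurable_input_triple k : measurable_fun setT (input_triple k).
Proof. by apply: measurable_fun_pair => //; apply: measurable_fun_pair. Qed.

Let input_events_measurable k A : input_events k A -> measurable A.
Proof.
by case: k => k [B mB <-]; rewrite setTI -[X in measurable X]setTI;
  exact: measurable_funPT.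
Qed.

Let event (Q : {set 'I_n + dyad n}) (A : 'I_n + dyad n -> set T) : set T :=
  \bigcap_(q in [set` Q]) A q.

Let event_measurable (Q : {set 'I_n + dyad n}) A : (forall q, q \in Q ->
  input_events q (A q)) ->
  measurable (event Q A).
Proof.
by move=> QA; apply: fin_bigcap_measurable => // q qQ;
  apply: (@input_events_measurable q); exact: QA.
Qed.

Let event_prod (Q : {set 'I_n + dyad n}) A : (forall q, q \in Q -> input_events
  q (A q)) ->
  Pr (event Q A) = \prod_(q in Q) Pr (A q).
Proof. by move=> QA; case: iid => _ _; apply. Qed.

Let eventU (Q Q' : {set 'I_n + dyad n}) A : [disjoint Q & Q']%B ->
    (forall q, q \in Q :|: Q' -> input_events q (A q)) ->
  Pr (event (Q :|: Q') A) = Pr (event Q A) * Pr (event Q' A).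
Proof.
move=> dQ QA; rewrite !event_prod//; last 2 first.
- by move=> q qQ; apply: QA; rewrite inE qQ orbT.
- by move=> q qQ; apply: QA; rewrite inE qQ.
by rewrite -bigU//; apply: eq_bigl => q; rewrite !inE.
Qed.

Variable phi : M * M * E -> R.
Hypotheses (mphi : measurable_fun setT phi) (phi0 : forall x, (0 <= phi x)%R).

Let W (s : seq (dyad n)) (w : T) : R := (\prod_(k <- s) phi (input_triple k w))%R.

Let measurable_W s : measurable_fun setT (W s).
Proof.
apply: measurable_prod => k _; apply: measurableT_comp => //.
exact: measurable_input_triple.
Qed.

Let event_inputs_rect (k : dyad n) (a b : set M) (c : set E)
    (B : 'I_n + dyad n -> set T) :
  (forall i, B (inl i) = mu i @^-1` (if i == (val k).1 then a else b)) ->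
  (forall l, B (inr l) = eps l @^-1` c) ->
  event (dyad_inputs k) B = input_triple k @^-1` (a `*` b `*` c).
Proof.
move=> Bl Br; apply/seteqP; split => [w Bw|w [[/= aw bw] cw]].
  have k12 : ((val k).2 == (val k).1) = false by rewrite eq_sym (negbTE (valP k)).
  split; [split|]; rewrite /input_triple /=.
  - by have := Bw (inl (val k).1); rewrite Bl eqxx; apply; rewrite /= !inE eqxx.
  - by have := Bw (inl (val k).2); rewrite Bl k12; apply; rewrite /= !inE eqxx orbT.
  - by have := Bw (inr k); rewrite Br; apply; rewrite /= !inE eqxx orbT.
move=> q /= /finset.setUP[/finset.set2P[]|/finset.set1P] ->.
- by rewrite Bl eqxx.
- by rewrite Bl eq_sym (negbTE (valP k)).
- by rewrite Br.
Qed.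

(** The product formula alone does not carry the induction: the product over the matching must also
    be independent of every event on inputs that the matching avoids. Peeling off a dyad moves its
    three inputs into that event, which is why [Q] is quantified inside the induction. *)
Let W_indep s : matching s ->
  (forall (Q : {set 'I_n + dyad n}) A,
    (forall k, k \in s -> [disjoint dyad_inputs k & Q]%B) ->
    (forall q, q \in Q -> input_events q (A q)) ->
    forall B, measurable B ->
      Pr (W s @^-1` B `&` event Q A) = Pr (W s @^-1` B) * Pr (event Q A)) /\
  \int[Pr]_w (W s w)%:E = \prod_(k <- s) \int[Pr]_w (phi (input_triple k w))%:E.
Proof.
elim: s => [_|k s IHs]; rewrite /matching /=.
  split; last first.
    rewrite big_nil; under eq_integral do rewrite /W big_nil.
    by rewrite integral_cst//= mul1e; exact: probability_setT.
  move=> Q A _ QA B mB; case: (pselect (B 1%R)) => B1.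
    rewrite (_ : W [::] @^-1` B = setT) ?setTI ?probability_setT ?mul1e//.
    by apply/seteqP; split => // w _; rewrite /W /= big_nil.
  rewrite (_ : W [::] @^-1` B = set0) ?set0I ?measure0 ?mul0e//.
  by apply/seteqP; split => // w; rewrite /W /= big_nil.
move=> /andP[/allP ks ms]; have {IHs} [IH IHint] := IHs ms.
have mtriple (l : dyad n) C : measurable C -> measurable (input_triple l @^-1` C).
  by move=> mC; rewrite -[X in measurable X]setTI; exact: measurable_input_triple.
have mWB l B : measurable B -> measurable (W l @^-1` B).
  by move=> mB; rewrite -[X in measurable X]setTI; exact: measurable_W.
have kP (Q0 : {set 'I_n + dyad n}) A0 B : measurable B ->
    (forall l, l \in k :: s -> [disjoint dyad_inputs l & Q0]%B) ->
    (forall q, q \in Q0 -> input_events q (A0 q)) ->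
    forall C, measurable C ->
  Pr (input_triple k @^-1` C `&` (W s @^-1` B `&` event Q0 A0)) =
  Pr (input_triple k @^-1` C) * (Pr (W s @^-1` B) * Pr (event Q0 A0)).
  move=> mB skQ0 Q0A.
  rewrite -IH//; last by move=> l ls; apply: skQ0; rewrite inE ls orbT.
  move=> C mC; apply: (indep_generated (measurable_prod3 _ _ _)) => //.
  - move=> _ _ [a ma [[b c] [/= mb mc] <-]] [a' ma' [[b' c'] [/= mb' mc'] <-]].
    rewrite -!setXI; exists (a `&` a'); first exact: measurableI.
    by exists (b `&` b', c `&` c') => //; split => /=; exact: measurableI.
  - by exists setT => //; exists (setT, setT) => //=; rewrite !setXTT.
  - exact: measurable_input_triple.
  - by apply: measurableI; [exact: mWB|exact: event_measurable].
  move=> _ [a ma [[b c] [/= mb mc] <-]].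
  (* [A'] glues the sides of the box to the conditions on [Q0]. Every vertex other than the first
     endpoint receives the side [b]; among the inputs of [k] this concerns the second endpoint
     only. *)
  pose A' q := if q \in Q0 then A0 q else match q with
    | inl i => mu i @^-1` (if i == (val k).1 then a else b)
    | inr l => eps l @^-1` c end.
  pose A'' (q : 'I_n + dyad n) := match q with
    | inl i => mu i @^-1` (if i == (val k).1 then a else b)
    | inr l => eps l @^-1` c end.
  have dk : [disjoint dyad_inputs k & Q0]%B by apply: skQ0; rewrite inE eqxx.
  have A'in q : q \in dyad_inputs k -> A' q = A'' q.
    by move=> qk; rewrite /A' (disjointFr dk qk).
  have ek : event (dyad_inputs k) A' = input_triple k @^-1` (a `*` b `*` c).
    rewrite -(@event_inputs_rect _ _ _ _ A'')//.
    by apply: eq_bigcapr => q qk; exact: A'in.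
  have eQ : event Q0 A' = event Q0 A0.
    by apply: eq_bigcapr => q qk; rewrite /A' qk.
  have A'P q : q \in dyad_inputs k :|: Q0 -> input_events q (A' q).
    rewrite inE /A'; case: ifPn => [qQ _|qQ _]; first exact: Q0A.
    case: q qQ => [i|l] _ /=; last by exists c; rewrite ?setTI.
    by case: ifPn => _; [exists a|exists b]; rewrite ?setTI.
  have eU : event (dyad_inputs k :|: Q0) A' =
      input_triple k @^-1` (a `*` b `*` c) `&` event Q0 A0.
    rewrite -ek -eQ /event -bigcap_setU; congr (\bigcap_(q in _) _).
    apply/seteqP; split => q /=; first by rewrite inE => /orP[]; [left|right].
    by case => qQ; apply/finset.setUP; [left|right].
  rewrite setICA -eU IH//; last first.
    move=> l ls; rewrite -finset.setI_eq0 finset.setIUr finset.setU_eq0.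
    rewrite !finset.setI_eq0 skQ0 ?inE ?ls ?orbT// andbT disjoint_sym.
    exact: ks.
  rewrite eventU// ek eQ IH// 1?muleCA//.
  by move=> l ls; apply: skQ0; rewrite inE ls orbT.
have tW A B : measurable A -> measurable B ->
    Pr (input_triple k @^-1` A `&` W s @^-1` B) =
    Pr (input_triple k @^-1` A) * Pr (W s @^-1` B).
  move=> mA mB; have := @kP finset.set0 (fun=> setT) B mB _ _ A mA.
  have -> : event finset.set0 (fun=> setT) = setT.
    by apply/seteqP; split => // w _ q; rewrite /= inE.
  rewrite ?setIT ?probability_setT ?mule1; apply.
  - by move=> l _; rewrite -finset.setI_eq0 finset.setI0.
  - by move=> q; rewrite inE.
have mpt : measurable_fun setT (phi \o input_triple k).
  by apply: measurableT_comp => //; exact: measurable_input_triple.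
split; last first.
  rewrite big_cons -IHint -integral_prod_indep//.
  - by apply: eq_integral => w _; rewrite /W big_cons.
  - move=> A B mA mB; rewrite -[X in Pr (X `&` _)]/(input_triple k @^-1` (phi
    @^-1` A)) tW//.
    by rewrite -[X in measurable X]setTI; exact: mphi.
  - by move=> w; apply: prodr_ge0.
move=> Q A skQ QA B mB.
pose f (z : (M * M * E) * R) : R := (phi z.1 * z.2)%R.
have mf : measurable_fun setT f.
  by apply: measurable_funM => //; apply: measurableT_comp.
pose V w := (input_triple k w, W s w).
have WE : W (k :: s) = f \o V by apply/funext => w; rewrite /W big_cons.
have mfB : measurable (f @^-1` B) by rewrite -[X in measurable X]setTI; exact: mf.
have mV : measurable_fun setT V.
  by apply: measurable_fun_pair; [exact: measurable_input_triple|].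
rewrite WE comp_preimage.
(* The new product is a function of the pair formed by the triple at [k] and the product over [s].
   Rectangles generate, and on them [kP] and [tW] factor the probability. *)
apply: (indep_generated (measurable_prod_measurableType _ _)) => //.
- move=> _ _ [a ma [b mb <-]] [a' ma' [b' mb' <-]].
  by rewrite -setXI; exists (a `&` a'); [exact: measurableI|
    exists (b `&` b') => //; exact: measurableI].
- by exists setT => //; exists setT => //; rewrite setXTT.
- exact: event_measurable.
move=> _ [a ma [b mb <-]].
have VE : V @^-1` (a `*` b) = input_triple k @^-1` a `&` W s @^-1` b by [].
rewrite VE -setIA kP// muleA; congr (_ * _).
by rewrite tW.
Qed.

Lemma integral_prod_matching s : matching s ->
  \int[Pr]_w (\prod_(k <- s) phi (input_triple k w))%:E =
  \prod_(k <- s) \int[Pr]_w (phi (input_triple k w))%:E.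
Proof. by case/W_indep. Qed.

End dyadic_independence.

(** * Exponential moments of dyadic sums *)

Section exponential_moments.
Context (R : realType).

(** Squaring [1 - y / 2 <= exp (- y / 2)] bounds [exp (- y)] from below. The quadratic times this
    lower bound is [1 + y ^ 2 (5 - 2 y) (1 - y) / 4], which is at least 1 when [y <= 1]. *)
Lemma expR_le_quadratic (y : R) : y <= 1 -> expR y <= 1 + y + 2 * y ^+ 2.
Proof.
move=> y1; have e2 : 1 - y / 2 <= expR (- (y / 2)).
  by have := expR_ge1Dx (- (y / 2)).
have h0 : 0 <= 1 - y / 2 by lra.
have e3 : (1 - y / 2) ^+ 2 <= expR (- y).
  rewrite [in expR _](_ : - y = 2%:R * - (y / 2)) ?expRM_natl; last by field.
  rewrite lerXn2r ?nnegrE ?expR_ge0 //.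
have q0 : 0 <= 1 + y + 2 * y ^+ 2.
  rewrite (_ : _ + _ = 2 * (y + 1 / 4) ^+ 2 + 7 / 8); last by field.
  have := sqr_ge0 (y + 1 / 4); lra.
have y2 : 0 <= y ^+ 2 * (5 - 2 * y) * (1 - y).
  by apply: mulr_ge0; [apply: mulr_ge0; [exact: sqr_ge0|lra]|lra].
rewrite -[leLHS]mul1r -ler_pdivlMr ?expR_gt0// -expRN.
apply: (le_trans _ (ler_wpM2l q0 e3)).
rewrite -subr_ge0; rewrite (_ : _ - 1 = y ^+ 2 * (5 - 2 * y) * (1 - y) / 4)
  ?divr_ge0//.
by field.
Qed.

Context d (U : measurableType d) (P : probability U R).

Lemma integrable_bounded (h : U -> R) b : measurable_fun setT h ->
  (forall x, `|h x| <= b) -> P.-integrable setT (EFin \o h).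
Proof.
move=> mh hb; apply: measurable_bounded_integrable => //.
  by apply: le_lt_trans (ltry 1); exact: probability_le1.
by exists b; split; [exact: num_real|move=> B /ltW bB x _ /=; exact: le_trans
  (hb x) bB].
Qed.

Lemma Rintegral_cst1 (r : R) : \int[P]_x (fun=> r) x = r.
Proof. by rewrite Rintegral_cst// [X in fine X](probability_setT P)/= mulr1. Qed.

Lemma Rintegral_bound (h : U -> R) b : measurable_fun setT h ->
  (forall x, `|h x| <= b) -> `|\int[P]_x h x| <= b.
Proof.
move=> mh hb; have ih := integrable_bounded mh hb.
apply: (le_trans (le_normr_Rintegral _ ih)) => //.
rewrite -[leRHS]Rintegral_cst1; apply: le_Rintegral => //.
  exact: (integrable_norm ih).
by apply: (@integrable_bounded _ `|b|).
Qed.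

(** Bernstein's argument: [h] differs from its mean by at most [2 b], so [2 t b <= 1] keeps the
    exponent below 1. There the exponential is dominated by a quadratic, whose linear part has mean
    zero. *)
Lemma integral_expR_center (h : U -> R) (b s2 t : R) :
  measurable_fun setT h -> (forall x, `|h x| <= b) ->
  \int[P]_x (h x ^+ 2) <= s2 -> 0 <= t -> 2 * t * b <= 1 ->
  (\int[P]_x (expR (t * (h x - \int[P]_y h y)))%:E <=
   (expR (2 * t ^+ 2 * s2))%:E)%E.
Proof.
move=> mh hb hs t0 tb; set m := \int[P]_y h y.
have mb : `|m| <= b by exact: Rintegral_bound.
have ih := integrable_bounded mh hb.
have mh2 : measurable_fun setT (fun x => h x ^+ 2) by exact: measurable_funX.
have ih2 : P.-integrable setT (EFin \o (fun x => h x ^+ 2)).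
  apply: (@integrable_bounded _ (b ^+ 2)) => // x.
  by rewrite normrX lerXn2r// ?nnegrE// (le_trans _ (hb x)).
have ic c : P.-integrable setT (EFin \o (fun=> c : R)).
  by apply: (@integrable_bounded _ `|c|).
(* The quadratic bound at [t (h x - m)], sorted by powers of [h x]. It integrates to
   [1 + 2 t ^ 2 (I - m ^ 2)], with [I] the integral of [h ^ 2]. *)
pose q x := 1 - t * m + 2 * t ^+ 2 * m ^+ 2
  + (t - 4 * t ^+ 2 * m) * h x + 2 * t ^+ 2 * h x ^+ 2.
have iq1 : P.-integrable setT (EFin \o (fun x => (t - 4 * t ^+ 2 * m) * h x)).
  exact: (integrableZl measurableT (t - 4 * t ^+ 2 * m) ih).
have iq2 : P.-integrable setT (EFin \o (fun x => 2 * t ^+ 2 * h x ^+ 2)).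
  exact: (integrableZl measurableT (2 * t ^+ 2) ih2).
have iq3 : P.-integrable setT (EFin \o
    (fun x => 1 - t * m + 2 * t ^+ 2 * m ^+ 2 + (t - 4 * t ^+ 2 * m) * h x)).
  by have := integrableD measurableT (ic (1 - t * m + 2 * t ^+ 2 * m ^+ 2)) iq1.
have iq : P.-integrable setT (EFin \o q).
  by have := integrableD measurableT iq3 iq2.
apply: (@le_trans _ _ (\int[P]_x (q x)%:E)%E).
  apply: ge0_le_integral => //.
  - apply/measurable_EFinP; apply: measurableT_comp => //.
    by apply: measurable_funM => //; apply: measurable_funB.
  - by case/integrableP: iq.
  move=> x _; rewrite lee_fin.
  have hx := hb x.
  have : t * (h x - m) <= 1.
    apply: le_trans tb; rewrite (mulrC 2) -mulrA; apply: ler_wpM2l => //.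
    have := ler_norm (h x); have := ler_norm (- m); rewrite normrN; lra.
  move=> /expR_le_quadratic /le_trans; apply.
  by rewrite le_eqVlt; apply/orP; left; apply/eqP; rewrite /q; ring.
rewrite -(@fineK _ (\int[P]_x (q x)%:E)%E); last exact: integrable_fin_num.
rewrite lee_fin -/(Rintegral P setT q).
rewrite RintegralD// RintegralD// RintegralZl// RintegralZl// Rintegral_cst1 -/m.
apply: (@le_trans _ _ (1 + 2 * t ^+ 2 * s2)); last exact: expR_ge1Dx.
have : 0 <= t ^+ 2 * (s2 - \int[P]_x (h x ^+ 2)) by rewrite mulr_ge0 ?sqr_ge0//
  subr_ge0.
have : 0 <= t ^+ 2 * m ^+ 2 by rewrite mulr_ge0 ?sqr_ge0.
lra.
Qed.

End exponential_moments.

(** * Splitting the dyads into matchings *)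

Section dyad_classes.
Variable n : nat.
Hypothesis n2 : (2 <= n)%N.

(** A round-robin schedule: once [i + j] is fixed modulo [n], either endpoint determines the other.
    Hence a class has at most [n] dyads, and dyads of one class cannot share an endpoint in the same
    position. *)
Definition dyad_class (c : 'I_n * bool) (k : dyad n) :=
  (((val k).1 + (val k).2) %% n == c.1 :> nat)%N &&
  (((val k).1 < (val k).2)%N == c.2).

Lemma dyad_class_exists (k : dyad n) : exists c, dyad_class c k.
Proof.
have n0 : (0 < n)%N by exact: leq_trans n2.
exists (Ordinal (ltn_pmod ((val k).1 + (val k).2) n0), ((val k).1 < (val k).2)%N).
by rewrite /dyad_class /= !eqxx.
Qed.

Definition dyad_class_of (k : dyad n) : 'I_n * bool :=
  xchoose (dyad_class_exists k).

Lemma dyad_class_ofP k c : (dyad_class_of k == c) = dyad_class c k.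
Proof.
have /andP[/eqP h1 /eqP h2] := xchooseP (dyad_class_exists k).
apply/eqP/andP => [<-|[/eqP g1 /eqP g2]]; first by split; exact/eqP.
rewrite /dyad_class_of (surjective_pairing (xchoose _)) (surjective_pairing c).
by congr pair; [apply: val_inj; rewrite /= -h1 -g1|rewrite -h2 -g2].
Qed.

Lemma addn_mod_inj (i j j' : 'I_n) : (i + j = i + j' %[mod n])%N -> j = j'.
Proof.
by move/eqP; rewrite eqn_modDl !modn_small// => /eqP jj; exact: val_inj.
Qed.

Lemma dyad_class_inj c k l : dyad_class c k -> dyad_class c l ->
  (val k).1 = (val l).1 \/ (val k).2 = (val l).2 -> k = l.
Proof.
move=> /andP[/eqP k1 _] /andP[/eqP l1 _] kl.
apply: val_inj; rewrite [LHS]surjective_pairing [RHS]surjective_pairing.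
case: kl => kl; rewrite kl; congr pair.
  by apply: (@addn_mod_inj (val l).1); rewrite -{1}kl k1 l1.
by apply: (@addn_mod_inj (val l).2); rewrite ![((val l).2 + _)%N]addnC -{1}kl k1 l1.
Qed.

(* Dyads of a class with [i = j'] would chain two inequalities of the same
   direction: this is why classes record the order of the endpoints. *)
Lemma dyad_class_cross c k l : dyad_class c k -> dyad_class c l ->
  (val k).1 != (val l).2.
Proof.
move=> /andP[/eqP k1 /eqP k2] /andP[/eqP l1 /eqP l2]; apply/eqP => kl.
have kl' : (val k).2 = (val l).1.
  by apply: (@addn_mod_inj (val k).1); rewrite k1 -l1 addnC kl.
move: k2 l2; rewrite kl kl'; case: c.2.
  by move=> h1 h2; move: (ltn_trans h1 h2); rewrite ltnn.
move=> /negbT; rewrite -leqNgt => h1 /negbT; rewrite -leqNgt => h2.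
have := valP l; rewrite /= -val_eqE /= eqn_leq.
by rewrite h1 h2.
Qed.

Lemma matching_dyad_class c :
  matching [seq k <- enum {: dyad n} | dyad_class c k].
Proof.
rewrite /matching; set s := [seq k <- _ | _].
have us : uniq s by rewrite filter_uniq// enum_uniq.
have sP k : k \in s -> dyad_class c k by rewrite mem_filter => /andP[].
elim: s us sP => //= k s IH /andP[ks us] sP; rewrite IH//; last first.
  by move=> l ls; apply: sP; rewrite inE ls orbT.
rewrite andbT; apply/allP => l ls.
have ck : dyad_class c k by apply: sP; rewrite inE eqxx.
have cl : dyad_class c l by apply: sP; rewrite inE ls orbT.
have kl : k != l by apply: contraNneq ks => ->.
rewrite disjoint_subset; apply/fintype.subsetP => q.
move=> /finset.setUP[/finset.set2P[]|/finset.set1P] ->; rewrite !inE /= ?orbF.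
- rewrite negb_or; apply/andP; split.
    by apply: contra_neq kl => -[] h; apply: (dyad_class_inj ck cl); left.
  by apply: contra_neq (dyad_class_cross ck cl) => -[].
- rewrite negb_or; apply/andP; split.
    by apply: contra_neq (dyad_class_cross cl ck) => -[].
  by apply: contra_neq kl => -[] h; apply: (dyad_class_inj ck cl); right.
- by apply: contra_neq kl => -[].
Qed.

Lemma size_dyad_class c :
  (size [seq k <- enum {: dyad n} | dyad_class c k] <= n)%N.
Proof.
rewrite -(size_map (fun k : dyad n => (val k).1)) -[leqRHS]size_enum_ord.
apply: uniq_leq_size; last by move=> i _; rewrite mem_enum.
rewrite map_inj_in_uniq => [|k l]; first by rewrite filter_uniq ?enum_uniq.
rewrite !mem_filter => /andP[ck _] /andP[cl _] kl.
by apply: (dyad_class_inj ck cl); left.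
Qed.

End dyad_classes.

(** Jensen's inequality from the tangent line at the mean: [exp y >= exp m * (1 + (y - m))], and the
    linear terms cancel in the sum. *)
Lemma expR_mean_le (R : realType) (I : finType) (y : I -> R) : (0 < #|I|)%N ->
  expR ((\sum_i y i) / #|I|%:R) <= (\sum_i expR (y i)) / #|I|%:R.
Proof.
move=> I0; have N0 : 0 < #|I|%:R :> R by rewrite ltr0n.
set m := _ / _; rewrite ler_pdivlMr//.
have -> : expR m * #|I|%:R = \sum_i expR m * (1 + (y i - m)).
  rewrite -mulr_sumr big_split/= sumrB !sumr_const -[1 *+ _]/(#|I|%:R).
  rewrite -[m *+ _]mulr_natr /m divfK ?lt0r_neq0//.
  by rewrite subrr addr0.
apply: ler_sum => i _; apply: (@le_trans _ _ (expR m * expR (y i - m))).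
  by rewrite ler_pM2l ?expR_gt0// expR_ge1Dx.
by rewrite -expRD addrC subrK.
Qed.

(** * Laplace transform of the dyadic sum *)

Section dyadic_deviation.
Context (R : realType) d (T : measurableType d) (Pr : probability T R).
Context (n : nat) dM (M : measurableType dM) dE (E : measurableType dE).
Variables (mu : 'I_n -> {mfun T >-> M}) (eps : dyad n -> {mfun T >-> E}).
Hypothesis iid : iid_inputs Pr mu eps.
Context d' (U : measurableType d') (F : {mfun (M * M * E)%type >-> U}).
Variable P : probability U R.
Hypothesis law : forall (k : dyad n) (A : set U), measurable A ->
  P A = Pr (dyadic_data mu eps F k @^-1` A).
Hypothesis n2 : (2 <= n)%N.

Let X := dyadic_data mu eps F.

Lemma measurable_dyadic_data k : measurable_fun setT (X k).
Proof.
by apply: (measurableT_comp (f := F)) => //; exact: measurable_input_triple.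
Qed.

Lemma integral_dyadic_data k (f : U -> \bar R) : measurable_fun setT f ->
  (forall u, 0 <= f u)%E -> (\int[Pr]_w f (X k w) = \int[P]_u f u)%E.
Proof.
move=> mf f0.
pose X' : {mfun T >-> U} :=
  HB.pack (X k) (isMeasurableFun.Build _ _ _ _ (X k) (measurable_dyadic_data k)).
transitivity (\int[distribution Pr X']_u f u)%E.
  by rewrite ge0_integral_distribution.
by apply: eq_measure_integral => A mA _; exact/esym/law.
Qed.

Definition deviation (h : U -> R) (w : T) : R :=
  \sum_(k : dyad n) (h (X k w) - \int[P]_u h u).

Lemma measurable_deviation h : measurable_fun setT h ->
  measurable_fun setT (deviation h).
Proof.
move=> mh; apply: measurable_sum => k; apply: measurable_funB => //.
by apply: measurableT_comp => //; exact: measurable_dyadic_data.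
Qed.

Variables (h : U -> R) (b s2 : R).
Hypotheses (mh : measurable_fun setT h) (hb : forall u, `|h u| <= b).
Hypothesis hs : \int[P]_u (h u ^+ 2) <= s2.

Let class_seq (c : 'I_n * bool) := [seq k <- enum {: dyad n} | dyad_class c k].

Let class_sum (c : 'I_n * bool) (w : T) : R :=
  \sum_(k <- class_seq c) (h (X k w) - \int[P]_u h u).

Let s20 : 0 <= s2.
Proof. by apply: le_trans hs; apply: Rintegral_ge0 => u _; exact: sqr_ge0. Qed.

Let measurable_class_sum c : measurable_fun setT (class_sum c).
Proof.
apply: measurable_sum => k; apply: measurable_funB => //.
by apply: measurableT_comp => //; exact: measurable_dyadic_data.
Qed.

Let integral_expR_class c t : 0 <= t -> 2 * t * b <= 1 ->
  (\int[Pr]_w (expR (t * class_sum c w))%:E <= (expR (2 * t ^+ 2 * s2 *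
    n%:R))%:E)%E.
Proof.
move=> t0 tb; set m := \int[P]_u h u.
have mhe : measurable_fun setT (fun u => expR (t * (h u - m))).
  by apply: measurableT_comp => //; apply: measurable_funM => //; apply:
    measurable_funB.
pose phi (z : M * M * E) := expR (t * (h (F z) - m)).
have mphi : measurable_fun setT phi by rewrite /phi; apply: (measurableT_comp mhe).
under eq_integral => w _.
  rewrite /class_sum mulr_sumr expR_sum.
  rewrite (_ : \prod_(_ <- _) _ = \prod_(k <- class_seq c) phi (input_triple mu
    eps k w)); last by [].
  over.
rewrite integral_prod_matching//; last 2 first.
- by move=> z; exact: expR_ge0.
- exact: matching_dyad_class.
have factor k : (0 <= \int[Pr]_w (phi (input_triple mu eps k w))%:E <= (expR (2
  * t ^+ 2 * s2))%:E)%E.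
  apply/andP; split; first by apply: integral_ge0 => w _; rewrite lee_fin expR_ge0.
  rewrite (_ : integral _ _ _ = \int[P]_u (expR (t * (h u - m)))%:E)%E.
    exact: integral_expR_center hb hs t0 tb.
  rewrite -(@integral_dyadic_data k)//; exact/measurable_EFinP.
have prod_le l : (0 <= \prod_(k <- l) \int[Pr]_w (phi (input_triple mu eps k
  w))%:E <=
    (expR (2 * t ^+ 2 * s2 * (size l)%:R))%:E)%E.
  elim: l => [|k l /andP[IH0 IH1]]; first by rewrite big_nil mulr0 expR0 lexx lee01.
  have /andP[f0 f1] := factor k.
  rewrite big_cons mule_ge0//= -[(size l).+1%:R]natr1 mulrDr mulr1 addrC expRD
    EFinM.
  exact: lee_pmul.
have /andP[_ prodc] := prod_le (class_seq c); apply: (le_trans prodc).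
rewrite lee_fin ler_expR ler_wpM2l//; last by rewrite ler_nat; exact:
  size_dyad_class.
by rewrite !mulr_ge0 ?sqr_ge0.
Qed.

(** The scaling [t / (2 n)] turns the dyadic sum into the mean over the [2 n] classes of [t] times
    the class sums. Jensen's inequality is insensitive to the dependence between classes, and each
    class contributes at most [n] independent factors bounded by [exp (2 t ^ 2 s2)]. *)
Lemma integral_expR_deviation t : 0 <= t -> 2 * t * b <= 1 ->
  (\int[Pr]_w (expR (t / (2 * n%:R) * deviation h w))%:E <=
   (expR (2 * t ^+ 2 * s2 * n%:R))%:E)%E.
Proof.
move=> t0 tb.
have n0 : (0 < n)%N by exact: leq_trans n2.
have N : #|{: 'I_n * bool}| = (2 * n)%N by rewrite card_prod card_ord card_bool
  mulnC.
have N0 : (0 < #|{: 'I_n * bool}|)%N by rewrite N muln_gt0.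
have devE w : t / (2 * n%:R) * deviation h w =
    (\sum_c t * class_sum c w) / #|{: 'I_n * bool}|%:R.
  rewrite N natrM -mulr_sumr mulrAC; congr (_ * _ / _).
  rewrite /deviation (partition_big (dyad_class_of n2) predT)//=.
  apply: eq_bigr => c _; rewrite /class_sum big_filter big_enum_cond/=.
  by apply: eq_bigl => k; rewrite dyad_class_ofP.
under eq_integral do rewrite devE.
apply: (@le_trans _ _ (\int[Pr]_w
    ((#|{: 'I_n * bool}|%:R^-1)%:E * \sum_c (expR (t * class_sum c w))%:E))%E).
  apply: ge0_le_integral => //.
  - apply/measurable_EFinP; apply: measurableT_comp => //; apply:
    measurable_funM => //.
    by apply: measurable_sum => c; apply: measurable_funM.
  - apply: measurable_funeM; apply: emeasurable_sum => c.
    by apply/measurable_EFinP; apply: measurableT_comp => //; apply: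
      measurable_funM.
  by move=> w _; rewrite sumEFin -EFinM lee_fin [leRHS]mulrC; exact: expR_mean_le.
rewrite ge0_integralZl//; last 2 first.
- apply: emeasurable_sum => c.
  by apply/measurable_EFinP; apply: measurableT_comp => //; apply: measurable_funM.
- by move=> w _; apply: sume_ge0 => c _; rewrite lee_fin expR_ge0.
rewrite ge0_integral_sum//; last first.
  by move=> c; apply/measurable_EFinP; apply: measurableT_comp => //; apply:
    measurable_funM.
apply: (@le_trans _ _ ((#|{: 'I_n * bool}|%:R^-1)%:E *
    \sum_(c : 'I_n * bool) (expR (2 * t ^+ 2 * s2 * n%:R))%:E)%E).
  apply: lee_wpmul2l; first by rewrite lee_fin invr_ge0.
  by apply: lee_sum => c _; exact: integral_expR_class.
rewrite sumEFin -EFinM lee_fin sumr_const -[X in _ * X]mulr_natl. rewrite mulKf//.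
by rewrite pnatr_eq0 -lt0n.
Qed.

End dyadic_deviation.

(** * Truncated chains *)

Section truncated_chain.
Context (R : realType) (U : Type) (Fc : set (U -> R)).
Variables (rho : nat -> (U -> R) -> (U -> R)) (g : nat -> (U -> R) -> (U -> R)).
Variable thr : nat -> (U -> R) -> R.

Hypothesis rhoF : forall l f, Fc f -> Fc (rho l f).
Hypothesis rho_rho : forall j l f, (j <= l)%N -> Fc f -> rho j (rho l f) = rho j f.
Hypothesis rho0 : forall f, Fc f -> rho 0%N f = cst 0.
Hypothesis g_bound : forall l f f' u, Fc f -> Fc f' -> rho l f = rho l f' ->
  `|f u - f' u| <= g l (rho l f) u.
Hypothesis g_ge0 : forall l f u, Fc f -> 0 <= g l f u.

(** The majorants [g] are chosen level by level and need not decrease along a chain. Their running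
    minimum does, and it still dominates the distance from [f] to [rho l f]. *)
Fixpoint min_width l f u : R :=
  if l is l'.+1 then Num.min (min_width l' f u) (g l (rho l f) u)
  else g 0%N (rho 0%N f) u.

(** The chain is still followed at the point [u]: all earlier running widths stayed within their
    thresholds. The test lags by one level, so that [alive l.+1] depends on [f] only through
    [rho l f], and on it the width at level [l] is below the threshold. *)
Fixpoint alive l f u : bool :=
  if l is l'.+1 then alive l' f u && (min_width l' f u <= thr l' (rho l' f))
  else true.

Definition stops l f u : bool :=
  alive l f u && (thr l (rho l f) < min_width l f u).

Definition chain_incr l f u : R :=
  (rho l.+1 f u - rho l f u) * (alive l.+1 f u)%:R.

Definition chain_rem l f u : R := min_width l f u * (stops l f u)%:R.

Lemma min_width_rho j l f : (j <= l)%N -> Fc f ->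
  min_width j (rho l f) = min_width j f.
Proof.
move=> + Ff; elim: j => [|j IH] jl; apply/funext => u /=; rewrite rho_rho//.
by rewrite IH// ltnW.
Qed.

Lemma alive_rho j l f : (j <= l.+1)%N -> Fc f -> alive j (rho l f) = alive j f.
Proof.
move=> + Ff; elim: j => [//|j IH] jl; apply/funext => u /=.
by rewrite IH 1?ltnW// rho_rho// min_width_rho.
Qed.

Lemma chain_incr_rho l f : Fc f -> chain_incr l (rho l.+1 f) = chain_incr l f.
Proof.
move=> Ff; apply/funext => u; rewrite /chain_incr rho_rho//.
by rewrite rho_rho// alive_rho.
Qed.

Lemma chain_rem_rho l f : Fc f -> chain_rem l (rho l f) = chain_rem l f.
Proof.
move=> Ff; apply/funext => u; rewrite /chain_rem /stops min_width_rho//.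
by rewrite rho_rho// alive_rho.
Qed.

Lemma min_width_ge0 l f u : Fc f -> 0 <= min_width l f u.
Proof.
move=> Ff; elim: l => [|l IH] /=; first by apply: g_ge0; exact: rhoF.
by rewrite le_min IH/=; apply: g_ge0; exact: rhoF.
Qed.

Lemma min_width_le l f u : min_width l f u <= g l (rho l f) u.
Proof. by case: l => //= l; rewrite ge_min lexx orbT. Qed.

Lemma min_width_dist l f f' u : Fc f -> Fc f' ->
  (forall j, (j <= l)%N -> rho j f = rho j f') ->
  `|f u - f' u| <= min_width l f u.
Proof.
move=> Ff Ff'; elim: l => [|l IH] ff' /=; first by apply: g_bound => //; exact: ff'.
rewrite le_min IH => [|j jl]; last by apply: ff'; rewrite (leq_trans jl).
by apply: g_bound => //; exact: ff'.
Qed.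

Lemma dist_rho l f u : Fc f -> `|f u - rho l f u| <= min_width l f u.
Proof.
move=> Ff; apply: min_width_dist => //; first exact: rhoF.
by move=> j jl; rewrite rho_rho.
Qed.

Lemma dist_rhoS l f u : Fc f -> `|rho l.+1 f u - rho l f u| <= min_width l f u.
Proof.
move=> Ff; rewrite -(@min_width_rho l l.+1)// -(@rho_rho l l.+1)//.
by apply: dist_rho; exact: rhoF.
Qed.

Lemma alive_stops l f u :
  (alive l f u)%:R = (alive l.+1 f u)%:R + (stops l f u)%:R :> R.
Proof.
rewrite /stops /=; case: (alive l f u) => //=; last by rewrite addr0.
by rewrite ltNge; case: (_ <= _); rewrite ?addr0 ?add0r.
Qed.

(** Telescoping up to the level where the chain stops. The terms are the links actually followed,
    the error at the stopping level, and the error at depth [L] where no stop occurred. *)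
Lemma chain_decomp L f u : Fc f -> f u =
  \sum_(l < L) chain_incr l f u +
  \sum_(l < L.+1) (f u - rho l f u) * (stops l f u)%:R +
  (f u - rho L f u) * (alive L.+1 f u)%:R.
Proof.
move=> Ff; elim: L => [|L IH].
  rewrite big_ord0 big_ord1 add0r -mulrDr [X in _ * X]addrC -alive_stops/= mulr1.
  by rewrite rho0// subr0.
rewrite big_ord_recr/= [\sum_(l < L.+2) _]big_ord_recr/= {1}IH /chain_incr.
have := alive_stops L.+1 f u.
set x := \sum_(_ < _) _; set y := \sum_(_ < _) _ => e.
suff -> : (f u - rho L f u) * (alive L.+1 f u)%:R =
   (rho L.+1 f u - rho L f u) * (alive L.+1 f u)%:R +
   (f u - rho L.+1 f u) * (stops L.+1 f u)%:R +
   (f u - rho L.+1 f u) * (alive L.+2 f u)%:R by ring.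
by rewrite -addrA -mulrDr [in RHS](addrC (stops _ _ _)%:R) -e; ring.
Qed.

Lemma norm_chain_incr_le l f u : Fc f ->
  `|chain_incr l f u| <= min_width l f u * (alive l.+1 f u)%:R.
Proof.
by move=> Ff; rewrite normrM normr_nat; apply: ler_wpM2r => //; exact: dist_rhoS.
Qed.

Lemma chain_rem_ge0 l f u : Fc f -> 0 <= chain_rem l f u.
Proof. by move=> Ff; rewrite mulr_ge0// min_width_ge0. Qed.

(** A chain stopping at level [l.+1] has passed the test of level [l], so its remainder obeys the
    same bound as the increment out of level [l]. Both then share one exponential estimate; only the
    remainder at level 0 has no earlier level to lean on. *)
Lemma chain_remS_le l f u : Fc f ->
  chain_rem l.+1 f u <= min_width l f u * (alive l.+1 f u)%:R.
Proof.
move=> Ff; rewrite /chain_rem /stops; case: (alive l.+1 f u) => //=; last by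
  rewrite !mulr0.
rewrite mulr1; apply: (@le_trans _ _ (min_width l.+1 f u)); last by rewrite /=
  ge_min lexx.
rewrite -[leRHS]mulr1 ler_wpM2l ?min_width_ge0//.
  by rewrite -[_ <= _]/(0 <= min_width l.+1 f u) min_width_ge0.
by rewrite lern1 leq_b1.
Qed.

Lemma alive_le_thr l f u : min_width l f u * (alive l.+1 f u)%:R <= Num.max 0
  (thr l (rho l f)).
Proof.
rewrite le_max /=; case: (alive l f u) => /=; last by rewrite mulr0 lexx.
by case: (leP (min_width l f u)) => h; rewrite ?mulr1 ?h ?orbT// mulr0 lexx.
Qed.

(** At a stop the width exceeds the threshold, so multiplying by their ratio only increases it. This
    is Markov's device for trading a second moment against a small mean. *)
Lemma chain_rem_le l f u : Fc f -> 0 < thr l (rho l f) ->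
  chain_rem l f u <= min_width l f u ^+ 2 / thr l (rho l f).
Proof.
move=> Ff t0; rewrite /chain_rem /stops ler_pdivlMr// expr2 -mulrA.
rewrite ler_wpM2l ?min_width_ge0//; case: (alive l f u) => /=; last by rewrite
  mul0r min_width_ge0.
by case: ltP => [/ltW|_]; rewrite ?mul1r// mul0r min_width_ge0.
Qed.

Lemma chain_le L f u : Fc f -> 0 < thr L (rho L f) ->
  `|f u - \sum_(l < L) chain_incr l f u| <=
  \sum_(l < L.+1) chain_rem l f u + thr L (rho L f).
Proof.
move=> Ff t0; rewrite {1}(@chain_decomp L f u Ff).
set I := \sum_(l < L) _; set S := \sum_(l < L.+1) (_ * _); set Z := _ * _.
have -> : I + S + Z - I = S + Z by ring.
apply: (le_trans (ler_normD _ _)); apply: lerD.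
  apply: (le_trans (ler_norm_sum _ _ _)); apply: ler_sum => l _.
  by rewrite normrM normr_nat; apply: ler_wpM2r => //; exact: dist_rho.
rewrite normrM normr_nat.
apply: (le_trans (ler_wpM2r _ (dist_rho L u Ff))) => //.
by apply: (le_trans (alive_le_thr _ _ _)); rewrite max_r// ltW.
Qed.

End truncated_chain.

(** * The chaining bound for abstract chain data *)

Section chaining.
Context (R : realType) d (T : measurableType d) (Pr : probability T R).
Context (n : nat) dM (M : measurableType dM) dE (E : measurableType dE).
Variables (mu : 'I_n -> {mfun T >-> M}) (eps : dyad n -> {mfun T >-> E}).
Hypothesis iid : iid_inputs Pr mu eps.
Context d' (U : measurableType d') (F : {mfun (M * M * E)%type >-> U}).
Variable P : probability U R.
Hypothesis law : forall (k : dyad n) (A : set U), measurable A ->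
  P A = Pr (dyadic_data mu eps F k @^-1` A).
Hypothesis n2 : (2 <= n)%N.

Variable Fc : set (U -> R).
Variables (rho g : nat -> (U -> R) -> (U -> R)) (s : nat -> (U -> R) -> R).
Variables (Mb : R) (G : R).
Variables (m : nat -> nat) (r : nat -> nat -> U -> R).

Hypothesis mF : forall f, Fc f -> measurable_fun setT f.
Hypothesis rhoF : forall l f, Fc f -> Fc (rho l f).
Hypothesis rho_rho : forall j l f, (j <= l)%N -> Fc f -> rho j (rho l f) = rho j f.
Hypothesis F0 : Fc (cst 0).
Hypothesis rho0 : forall f, Fc f -> rho 0%N f = cst 0.
Hypothesis g_bound : forall l f f' u, Fc f -> Fc f' -> rho l f = rho l f' ->
  `|f u - f' u| <= g l (rho l f) u.
Hypothesis mg : forall l f, Fc f -> measurable_fun setT (g l f).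
Hypothesis g_ge0 : forall l f u, Fc f -> 0 <= g l f u.
Hypothesis g_le : forall l f u, Fc f -> g l f u <= Mb.
Hypothesis g_sqr : forall l f, Fc f -> \int[P]_u (g l f u ^+ 2) <= s l f ^+ 2.
Hypothesis s_gt0 : forall l f, Fc f -> 0 < s l f.
Hypothesis rho_enum : forall l f, Fc f -> exists2 i, (i < m l)%N & rho l f = r l i.
Hypothesis rF : forall l i, (i < m l)%N -> Fc (r l i).
Hypothesis m_le : forall l, (m l <= 2 ^ (2 ^ l))%N.
Hypothesis s_sum : forall f, Fc f ->
  \sum_(l < n.+1) Num.sqrt (2 ^+ l) * s l (rho l f) <= G.

Let N : R := #|{: dyad n}|%:R.
Let nR : R := n%:R.
Let rt (l : nat) : R := Num.sqrt (2 ^+ l).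
Let thr l f : R := Num.sqrt nR * s l f / rt l.
Let gm := min_width rho g.
Let al := alive rho g thr.
Let incr := chain_incr rho g thr.
Let rem := chain_rem rho g thr.
Let Y := deviation mu eps F P.
(** The scale of the deviations at level [l]. By [s_sum] these scales add up along a chain to at
    most [2 * n * sqrt n * G]. *)
Let nu l f : R := 2 * nR * Num.sqrt nR * (rt l * s l (rho l f)).
Let c : R := nR * Num.sqrt nR.

Let n0 : (0 < n)%N. Proof. exact: leq_trans n2. Qed.
Let nR_gt0 : 0 < nR. Proof. by rewrite ltr0n. Qed.
Let sn_gt0 : 0 < Num.sqrt nR. Proof. by rewrite sqrtr_gt0. Qed.
Let rt_gt0 l : 0 < rt l. Proof. by rewrite sqrtr_gt0 exprn_gt0. Qed.
Let rt_sqr l : rt l ^+ 2 = 2 ^+ l. Proof. by rewrite sqr_sqrtr// exprn_ge0. Qed.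
Let thr_gt0 l f : Fc f -> 0 < thr l f.
Proof. by move=> Ff; rewrite divr_gt0// mulr_gt0// s_gt0. Qed.
Let nu_gt0 l f : Fc f -> 0 < nu l f.
Proof. by move=> Ff; rewrite !mulr_gt0// s_gt0//; exact: rhoF. Qed.
Let c_gt0 : 0 < c. Proof. exact: mulr_gt0. Qed.

Let NE : N = nR * (nR - 1).
Proof. by rewrite /N card_dyad natrM -subn1 natrB. Qed.
Let N_le : N <= nR * nR.
Proof. by rewrite NE ler_pM2l// gerBl. Qed.
Let N_ge0 : 0 <= N. Proof. exact: ler0n. Qed.

Let measurable_gm l f : Fc f -> measurable_fun setT (gm l f).
Proof.
move=> Ff; elim: l => [|l IH]; first by apply: mg; exact: rhoF.
by apply: measurable_minr => //; apply: mg; exact: rhoF.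
Qed.

Let measurable_alive l f : Fc f -> measurable_fun setT (al l f).
Proof.
move=> Ff; elim: l => [|l IH]; first exact: measurable_cst.
by apply: measurable_and => //; apply: measurable_fun_ler => //; exact:
  measurable_gm.
Qed.

Let measurable_boolR (b : U -> bool) :
  measurable_fun setT b -> measurable_fun setT (fun u => (b u)%:R : R).
Proof.
move=> mb; apply: (@measurableT_comp _ _ _ _ _ _ (fun b : bool => b%:R : R)) => //.
Qed.

Let measurable_incr l f : Fc f -> measurable_fun setT (incr l f).
Proof.
move=> Ff; apply: measurable_funM.
  by apply: measurable_funB; apply: mF; exact: rhoF.
by apply: measurable_boolR; exact: measurable_alive.
Qed.

Let measurable_rem l f : Fc f -> measurable_fun setT (rem l f).
Proof.
move=> Ff; apply: measurable_funM; first exact: measurable_gm.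
apply: measurable_boolR; apply: measurable_and; first exact: measurable_alive.
by apply: measurable_fun_ltr => //; exact: measurable_gm.
Qed.

Let Mb_ge0 : 0 <= Mb.
Proof. by apply: le_trans (g_le 0%N point F0); exact: g_ge0. Qed.

Let gm_ge0 l f u : Fc f -> 0 <= gm l f u.
Proof. exact: min_width_ge0. Qed.

Let gm_le l f u : Fc f -> gm l f u <= Mb.
Proof. by move=> Ff; apply: (le_trans (min_width_le _ _ _ _ _));
  exact/g_le/rhoF. Qed.

Let integrable_bnd (h : U -> R) : measurable_fun setT h ->
  (forall u, `|h u| <= Mb) -> P.-integrable setT (EFin \o h).
Proof. exact: integrable_bounded. Qed.

Let integrable_sqr (h : U -> R) : measurable_fun setT h ->
  (forall u, `|h u| <= Mb) -> P.-integrable setT (EFin \o (fun u => h u ^+ 2)).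
Proof.
move=> mh hb; apply: (@integrable_bounded _ _ _ _ _ (Mb ^+ 2)).
  exact: measurable_funX.
by move=> u; rewrite normrX lerXn2r// ?nnegrE// (le_trans _ (hb u)).
Qed.

Let integral_sqr_le (h : U -> R) l f : Fc f -> measurable_fun setT h ->
  (forall u, `|h u| <= gm l f u) -> \int[P]_u (h u ^+ 2) <= s l (rho l f) ^+ 2.
Proof.
move=> Ff mh hg; have Fr := @rhoF l f Ff; apply: le_trans (@g_sqr l _ Fr).
apply: le_Rintegral => //.
- by apply: integrable_sqr => // u; apply: le_trans (gm_le l u Ff).
- by apply: integrable_sqr => [|u]; [exact: mg|rewrite ger0_norm ?g_ge0 ?g_le].
move=> u _; rewrite -[leLHS]real_normK ?num_real// lerXn2r ?nnegrE ?g_ge0//.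
by apply: (le_trans (hg u)); exact: min_width_le.
Qed.

(** The exponential at [t = 1 / (2 thr)], the largest parameter that Bernstein's bound allows: then
    [t / (2 n) = 2 ^ l / (2 nu)] and the moment is at most [exp (2 ^ l / 2)]. The shift [4 * 2 ^ l]
    pays for summing over the at most [exp (2 * 2 ^ l)] representatives of level [l.+1]. *)
Let ex (q : U -> R) l f w := expR (2 ^+ l / (2 * nu l f) * Y q w - 4 * 2 ^+ l).

Let ex_ge0 q l f w : 0 <= ex q l f w. Proof. exact: expR_ge0. Qed.

Let measurable_ex q l f : measurable_fun setT q -> measurable_fun setT (ex q l f).
Proof.
move=> mq; apply: measurableT_comp => //; apply: measurable_funB => //.
by apply: measurable_funM => //; exact: measurable_deviation.
Qed.

(** With [z] the exponent in [ex], the ratio [Y q w / nu l f] equals [8 + 2 z / 2 ^ l]; the 8 undoes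
    the shift, and [z <= exp z] does the rest. *)
Let dev_le_ex q l f w : Fc f -> Y q w <= nu l f * (8 + 2 * ex q l f w).
Proof.
move=> Ff; have nu0 := @nu_gt0 l f Ff.
have t1 : 1 <= 2 ^+ l :> R by rewrite exprn_ege1// ler1n.
have t0 : 0 < 2 ^+ l :> R by exact: lt_le_trans t1.
rewrite mulrC -ler_pdivrMr//.
set z := 2 ^+ l / (2 * nu l f) * Y q w - 4 * 2 ^+ l.
have zE : z <= ex q l f w by have := expR_ge1Dx z; rewrite /ex -/z; lra.
have -> : Y q w / nu l f = 8 + 2 * (z / 2 ^+ l).
  by rewrite /z; field; rewrite !gt_eqF.
rewrite lerD2l ler_pM2l// ler_pdivrMr//; apply: (le_trans zE).
by rewrite ler_peMr.
Qed.

Let integral_ex (q : U -> R) l f : Fc f -> measurable_fun setT q ->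
  (forall u, `|q u| <= gm l f u * (al l.+1 f u)%:R) ->
  (\int[Pr]_w (ex q l f w)%:E <= (expR (- (7 / 2) * 2 ^+ l))%:E)%E.
Proof.
move=> Ff mq qb; have nu0 := @nu_gt0 l f Ff.
have Fr := @rhoF l f Ff.
have th0 := @thr_gt0 l _ Fr.
have s0 := @s_gt0 l _ Fr.
have q_thr u : `|q u| <= thr l (rho l f).
  apply: (le_trans (qb u)); apply: (le_trans (alive_le_thr _ _ _ _ _ _)).
  by rewrite max_r// ltW.
have q_gm u : `|q u| <= gm l f u.
  apply: (le_trans (qb u)); rewrite -[leRHS]mulr1 ler_wpM2l ?gm_ge0//.
  by rewrite lern1 leq_b1.
have q_sqr := integral_sqr_le Ff mq q_gm.
pose t := (2 * thr l (rho l f))^-1.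
have t0 : 0 <= t by rewrite invr_ge0 mulr_ge0// ltW.
have tb : 2 * t * thr l (rho l f) <= 1.
  by rewrite /t (_ : _ * _ = 1)//; field; rewrite gt_eqF.
have := integral_expR_deviation iid law n2 mq q_thr q_sqr t0 tb.
have -> : t / (2 * n%:R) = 2 ^+ l / (2 * nu l f).
  rewrite /t /thr /nu -[2 ^+ l]rt_sqr -/nR; field.
  by rewrite !gt_eqF.
have -> : 2 * t ^+ 2 * s l (rho l f) ^+ 2 * n%:R = 2^-1 * 2 ^+ l.
  rewrite /t /thr -[2 ^+ l]rt_sqr -/nR; move: (sqr_sqrtr (ltW nR_gt0)) sn_gt0.
  move: (Num.sqrt nR) => sn <- sn0; field.
  by rewrite !gt_eqF.
move=> h; rewrite /ex.
under eq_integral do rewrite expRD EFinM muleC.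
rewrite ge0_integralZl//; last first.
  apply/measurable_EFinP; apply: measurableT_comp => //.
  by apply: measurable_funM => //; exact: measurable_deviation.
apply: (@le_trans _ _ ((expR (- (4 * 2 ^+ l)))%:E * (expR (2^-1 * 2 ^+ l))%:E)%E).
  by apply: lee_wpmul2l => //; rewrite lee_fin expR_ge0.
rewrite -EFinM -expRD lee_fin ler_expR.
by rewrite -subr_ge0 (_ : _ - _ = 0)//; field.
Qed.

Let incr_bound l f u : Fc f -> `|incr l f u| <= gm l f u * (al l.+1 f u)%:R.
Proof. exact: norm_chain_incr_le. Qed.

Let rem_bound l f u : Fc f -> `|rem l.+1 f u| <= gm l f u * (al l.+1 f u)%:R.
Proof.
by move=> Ff; rewrite ger0_norm;
  [exact: (@chain_remS_le _ _ Fc)|exact: (@chain_rem_ge0 _ _ Fc)].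
Qed.

(** A sum in place of a maximum: the exponentials are nonnegative, so [W] dominates each of them,
    while its mean is simply the sum of their means. *)
Let W w := \sum_(l < n) \sum_(i < m l.+1)
  (ex (incr l (r l.+1 i)) l (r l.+1 i) w + ex (rem l.+1 (r l.+1 i)) l (r l.+1 i) w).

Let W_ge0 w : 0 <= W w.
Proof. by apply: sumr_ge0 => l _; apply: sumr_ge0 => i _; rewrite addr_ge0. Qed.

Let nu_rho l f : Fc f -> nu l (rho l.+1 f) = nu l f.
Proof. by move=> Ff; rewrite /nu rho_rho. Qed.

Let dev_incr_rem l f w : (l < n)%N -> Fc f ->
  Y (incr l f) w <= nu l f * (8 + 2 * W w) /\
  Y (rem l.+1 f) w <= nu l f * (8 + 2 * W w).
Proof.
move=> ln Ff; have [i im ri] := rho_enum l.+1 Ff.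
have Fr := rF im; have nu0 := @nu_gt0 l f Ff.
have inc : incr l f = incr l (r l.+1 i) by rewrite -ri /incr (chain_incr_rho _
  _ rho_rho).
have rme : rem l.+1 f = rem l.+1 (r l.+1 i) by rewrite -ri /rem (chain_rem_rho
  _ _ rho_rho).
have nue : nu l (r l.+1 i) = nu l f by rewrite -ri nu_rho.
have exW : ex (incr l (r l.+1 i)) l (r l.+1 i) w +
    ex (rem l.+1 (r l.+1 i)) l (r l.+1 i) w <= W w.
  rewrite /W (bigD1 (Ordinal ln))//= (bigD1 (Ordinal im))//= -[leLHS]addr0 -addrA.
  apply: lerD => //; rewrite addr_ge0//; first by apply: sumr_ge0 => ? _;
    rewrite addr_ge0.
  by apply: sumr_ge0 => ? _; apply: sumr_ge0 => ? _; rewrite addr_ge0.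
have e1 := ex_ge0 (incr l (r l.+1 i)) l (r l.+1 i) w.
have e2 := ex_ge0 (rem l.+1 (r l.+1 i)) l (r l.+1 i) w.
rewrite inc rme -nue in nu0 *; split.
  apply: (le_trans (dev_le_ex _ l w Fr)); rewrite ler_wpM2l ?(ltW nu0)//; lra.
apply: (le_trans (dev_le_ex _ l w Fr)); rewrite ler_wpM2l ?(ltW nu0)//; lra.
Qed.

Let measurable_W : measurable_fun setT W.
Proof.
apply: measurable_sum => l.
apply: (@measurable_sum _ _ _ _ _ _ (fun (i : 'I_(m l.+1)) w =>
  ex (incr l (r l.+1 i)) l (r l.+1 i) w + ex (rem l.+1 (r l.+1 i)) l (r l.+1 i)
    w)) => i.
have Fr : Fc (r l.+1 i) by exact: rF.
by apply: measurable_funD; apply: measurable_ex; [exact: measurable_incr|exact: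
  measurable_rem].
Qed.

(* [2 ^ 2 ^ l.+1 = 4 ^ 2 ^ l <= exp (2 * 2 ^ l)] pairs of functions at level
   [l.+1], each contributing at most [exp (- 7 / 2 * 2 ^ l)]. *)
Let level_count l :
  (m l.+1)%:R * (2 * expR (- (7 / 2) * 2 ^+ l)) <= 2 * (2^-1) ^+ l :> R.
Proof.
have x0 : 0 < 2 ^+ l :> R by rewrite exprn_gt0.
have e2 : 2 <= expR 1 :> R by have := expR_ge1Dx (1 : R); lra.
have ml : (m l.+1)%:R <= expR (2 * 2 ^+ l) :> R.
  apply: (@le_trans _ _ ((2 ^ (2 ^ l.+1))%N%:R)); first by rewrite ler_nat.
  rewrite natrX (_ : 2 * 2 ^+ l = (2 ^ l.+1)%N%:R * 1); last by rewrite mulr1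
    natrX exprS.
  by rewrite expRM_natl lerXn2r ?nnegrE ?expR_ge0.
apply: (@le_trans _ _ (expR (2 * 2 ^+ l) * (2 * expR (- (7 / 2) * 2 ^+ l)))).
  by apply: ler_wpM2r => //; rewrite mulr_ge0// expR_ge0.
rewrite mulrCA ler_pM2l// -expRD exprVn.
rewrite (_ : 2 * 2 ^+ l + _ = - (3 / 2 * 2 ^+ l)); last by field.
rewrite expRN lef_pV2 ?posrE ?expR_gt0//.
by have := expR_ge1Dx (3 / 2 * 2 ^+ l : R); lra.
Qed.

Let integral_W : (\int[Pr]_w (W w)%:E <= 4%:E)%E.
Proof.
pose e l i w := (ex (incr l (r l.+1 i)) l (r l.+1 i) w +
   ex (rem l.+1 (r l.+1 i)) l (r l.+1 i) w)%:E.
have me l i : (i < m l.+1)%N -> measurable_fun setT (e l i).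
  move=> im; have Fr : Fc (r l.+1 i) by exact: rF.
  apply/measurable_EFinP.
  by apply: measurable_funD; apply: measurable_ex; [exact:
    measurable_incr|exact: measurable_rem].
have e0 l i w : (0 <= e l i w)%E by rewrite lee_fin addr_ge0.
have ie l i : (i < m l.+1)%N ->
    (\int[Pr]_w e l i w <= (2 * expR (- (7 / 2) * 2 ^+ l))%:E)%E.
  move=> im; have Fr : Fc (r l.+1 i) by exact: rF.
  under eq_integral do rewrite /e EFinD.
  rewrite ge0_integralD//; last 4 first.
  - by move=> w _; rewrite lee_fin.
  - by apply/measurable_EFinP; apply: measurable_ex; exact: measurable_incr.
  - by move=> w _; rewrite lee_fin.
  - by apply/measurable_EFinP; apply: measurable_ex; exact: measurable_rem.
  rewrite mulr_natl mulr2n EFinD; apply: leeD; apply: integral_ex => //.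
  - exact: measurable_incr.
  - by move=> u; exact: incr_bound.
  - exact: measurable_rem.
  - by move=> u; exact: rem_bound.
have -> : (\int[Pr]_w (W w)%:E = \int[Pr]_w \sum_(l < n) \sum_(i < m l.+1) e l
  i w)%E.
  apply: eq_integral => w _; rewrite /W -sumEFin; apply: eq_bigr => l _.
  by rewrite -sumEFin.
rewrite ge0_integral_sum//; last 2 first.
- by move=> l; apply: emeasurable_sum => i; exact: me.
- by move=> l w _; apply: sume_ge0 => i _.
apply: (@le_trans _ _ (\sum_(l < n) (2 * (2^-1) ^+ l)%:E)%E).
  apply: lee_sum => l _; rewrite ge0_integral_sum//; last by move=> i; exact: me.
  apply: (@le_trans _ _ (\sum_(i < m l.+1) (2 * expR (- (7 / 2) * 2 ^+ l))%:E)%E).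
    by apply: lee_sum => i _; exact: ie.
  by rewrite sumEFin lee_fin sumr_const card_ord -[leLHS]mulr_natl level_count.
rewrite sumEFin lee_fin -mulr_sumr.
have := subrX1 (2^-1 : R) n.
have : 0 <= (2^-1) ^+ n :> R by rewrite exprn_ge0// invr_ge0.
set S := \sum_(_ < _) _; lra.
Qed.

(** The level 0 remainder is below no earlier threshold, hence escapes the exponential estimate.
    Since all chains start at zero it is the same function for every [f], and the mean of this one
    sum suffices. *)
Let V w := \sum_(k : dyad n) rem 0%N (cst 0) (dyadic_data mu eps F k w).

Let rem0 f : Fc f -> rem 0%N f = rem 0%N (cst 0).
Proof. by move=> Ff; rewrite -(rho0 Ff) /rem (chain_rem_rho _ _ rho_rho). Qed.

Let V_ge0 w : 0 <= V w.
Proof. by apply: sumr_ge0 => k _; exact: (@chain_rem_ge0 _ _ Fc). Qed.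

Let measurable_V : measurable_fun setT V.
Proof.
apply: measurable_sum => k; apply: measurableT_comp; first exact: measurable_rem.
exact: measurable_dyadic_data.
Qed.

Let rem_le_Mb l f u : Fc f -> `|rem l f u| <= Mb.
Proof.
move=> Ff; rewrite ger0_norm; last exact: (@chain_rem_ge0 _ _ Fc).
apply: le_trans (gm_le l u Ff); rewrite -[leRHS]mulr1 ler_wpM2l ?gm_ge0//.
by rewrite lern1 leq_b1.
Qed.

Let incr_le_Mb l f u : Fc f -> `|incr l f u| <= Mb.
Proof.
move=> Ff; apply: (le_trans (incr_bound l u Ff)); apply: le_trans (gm_le l u Ff).
by rewrite -[leRHS]mulr1 ler_wpM2l ?gm_ge0// lern1 leq_b1.
Qed.

Let F_le_Mb f u : Fc f -> `|f u| <= Mb.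
Proof.
move=> Ff; rewrite -[f u]subr0 -[0]/(cst 0 u) -(rho0 Ff).
by apply: le_trans (gm_le 0%N u Ff); exact: (@dist_rho _ _ Fc).
Qed.

Let integral_rem l f : Fc f ->
  \int[P]_u rem l f u <= rt l * s l (rho l f) / Num.sqrt nR.
Proof.
move=> Ff; have Fr := @rhoF l f Ff; have th0 := @thr_gt0 l _ Fr.
have igm2 : P.-integrable setT (EFin \o (fun u => gm l f u ^+ 2)).
  by apply: integrable_sqr => [|u]; [exact: measurable_gm|rewrite ger0_norm
    ?gm_ge0 ?gm_le].
apply: (@le_trans _ _ (\int[P]_u (gm l f u ^+ 2 / thr l (rho l f)))).
  apply: le_Rintegral => //.
  - by apply: integrable_bnd => [|u]; [exact: measurable_rem|exact: rem_le_Mb].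
  - exact: (integrableZr measurableT (thr l (rho l f))^-1 igm2).
  - by move=> u _; exact: (@chain_rem_le _ _ Fc).
rewrite RintegralZr//.
have sq : \int[P]_u (gm l f u ^+ 2) <= s l (rho l f) ^+ 2.
  apply: integral_sqr_le => //; first exact: measurable_gm.
  by move=> u; rewrite ger0_norm// gm_ge0.
apply: (le_trans (ler_wpM2r _ sq)); first by rewrite invr_ge0 ltW.
rewrite /thr le_eqVlt; apply/orP; left; apply/eqP; field.
by rewrite !gt_eqF// s_gt0.
Qed.

Let Rintegral_sum L (h : nat -> U -> R) :
  (forall l, P.-integrable setT (EFin \o h l)) ->
  \int[P]_u (\sum_(l < L) h l u) = \sum_(l < L) \int[P]_u h l u /\
  P.-integrable setT (EFin \o (fun u => \sum_(l < L) h l u)).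
Proof.
move=> ih; elim: L => [|L [IHe IHi]].
  rewrite big_ord0; under eq_Rintegral do rewrite big_ord0.
  rewrite Rintegral_cst1; split => //.
  apply: (@integrable_bounded _ _ _ _ _ 0) => [|u]; last by rewrite big_ord0 normr0.
  rewrite (_ : (fun _ => _) = cst 0)//.
  by apply/funext => u; rewrite big_ord0.
have sE : (fun u => \sum_(l < L.+1) h l u) =
    (fun u => \sum_(l < L) h l u + h L u).
  by apply/funext => u; rewrite big_ord_recr.
rewrite sE big_ord_recr/= RintegralD// IHe; split => //.
exact: (integrableD measurableT IHi (ih L)).
Qed.

(** The approximation of [f] is used at the observation and, with the opposite sign, under [P]. A
    remainder therefore meets its mean with a plus sign, which is the centered remainder plus twice
    the mean; for the same reason the final threshold counts twice. *)
Let dev_le f w : Fc f -> Y f w <=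
  \sum_(l < n) Y (incr l f) w +
  \sum_(l < n.+1) (Y (rem l f) w + 2 * N * \int[P]_u rem l f u) +
  2 * N * thr n (rho n f).
Proof.
move=> Ff; have th0 := @thr_gt0 n _ (@rhoF n f Ff).
have iinc l : P.-integrable setT (EFin \o incr l f).
  by apply: integrable_bnd => [|u]; [exact: measurable_incr|exact: incr_le_Mb].
have irem l : P.-integrable setT (EFin \o rem l f).
  by apply: integrable_bnd => [|u]; [exact: measurable_rem|exact: rem_le_Mb].
have i_f : P.-integrable setT (EFin \o f).
  by apply: integrable_bnd => [|u]; [exact: mF|exact: F_le_Mb].
have [eI iI] := @Rintegral_sum n (fun l => incr l f) iinc.
have [eR iR] := @Rintegral_sum n.+1 (fun l => rem l f) irem.
set th := thr n (rho n f) in th0 *.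
have pt u : `|f u - \sum_(l < n) incr l f u| <= \sum_(l < n.+1) rem l f u + th.
  exact: (@chain_le _ _ Fc).
have ic : P.-integrable setT (EFin \o (fun=> th : R)).
  by apply: (@integrable_bounded _ _ _ _ _ `|th|).
have lo : \sum_(l < n) \int[P]_u incr l f u - \sum_(l < n.+1) \int[P]_u rem l f
  u - th
    <= \int[P]_u f u.
  rewrite -eI -eR -[th](Rintegral_cst1 P) -!RintegralB//; last first.
    exact: (integrableB measurableT iI iR).
  apply: le_Rintegral => //.
    exact: (integrableB measurableT (integrableB measurableT iI iR) ic).
  by move=> u _; have := pt u; rewrite ler_norml => /andP[+ _]; lra.
have step k : f (dyadic_data mu eps F k w) - \int[P]_u f u <=
    \sum_(l < n) (incr l f (dyadic_data mu eps F k w) - \int[P]_u incr l f u) +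
    \sum_(l < n.+1) (rem l f (dyadic_data mu eps F k w) + \int[P]_u rem l f u)
      + 2 * th.
  rewrite sumrB big_split/=.
  have := pt (dyadic_data mu eps F k w); rewrite ler_norml => /andP[_].
  move: lo; lra.
apply: (le_trans (ler_sum _ (fun k _ => step k))).
rewrite !big_split/= exchange_big/= [X in _ + X + _]exchange_big/= -big_split/=.
rewrite sumr_const -[X in _ + X](mulr_natl (2 * th)).
apply: lerD; last by rewrite mulrA [N * 2]mulrC.
apply: lerD => //; apply: ler_sum => l _.
rewrite /Y /deviation sumrB big_split/= !sumr_const -!(mulr_natl (\int[P]_u _)).
rewrite -/N; lra.
Qed.

Let Vmean : (\int[Pr]_w (V w)%:E = (N * \int[P]_u rem 0%N (cst 0) u)%:E)%E.
Proof.
have r0 u : 0 <= rem 0%N (cst 0) u by exact: (@chain_rem_ge0 _ _ Fc).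
have mr : measurable_fun setT (rem 0%N (cst 0)) by exact: measurable_rem.
have ir : P.-integrable setT (EFin \o rem 0%N (cst 0)).
  by apply: integrable_bnd => // u; exact: rem_le_Mb.
under eq_integral do rewrite /V -sumEFin.
rewrite ge0_integral_sum//; last 2 first.
- move=> k; apply/measurable_EFinP; apply: measurableT_comp => //.
  exact: measurable_dyadic_data.
- by move=> k w _; rewrite lee_fin.
transitivity (\sum_(k : dyad n) (\int[P]_u rem 0%N (cst 0) u)%:E)%E.
  apply: eq_bigr => k _.
  rewrite (integral_dyadic_data law k (f := fun u => (rem 0%N (cst 0) u)%:E))//.
    by rewrite fineK//; exact: integrable_fin_num.
  exact/measurable_EFinP.
by rewrite sumEFin sumr_const mulr_natl.
Qed.

Lemma chaining_bound : exists B : T -> R,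
  [/\ measurable_fun setT B, (forall w, 0 <= B w),
      (forall f w, Fc f -> deviation mu eps F P f w <= B w) &
      (\int[Pr]_w (B w)%:E <= (70 * (n%:R * Num.sqrt n%:R) * G)%:E)%E].
Proof.
have x_ge0 l f : Fc f -> 0 <= rt l * s l (rho l f).
  by move=> Ff; rewrite mulr_ge0// ltW// s_gt0//; exact: rhoF.
have G_ge0 : 0 <= G.
  by apply: le_trans (s_sum F0); apply: sumr_ge0 => l _; exact: x_ge0.
have cG : 0 <= c * G by rewrite mulr_ge0// ltW.
(* The 37 is 16 for the increments, 16 for the remainders past level 0, 2 for the means of the
   latter, 2 for the final threshold and 1 for level 0; the 8 is 4 + 4. As [W] has mean at most 4
   and [V] at most [c * G], the total mean is 37 + 32 + 1 = 70. *)
exists (fun w => c * G * (37 + 8 * W w) + V w); split.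
- apply: measurable_funD => //; apply: measurable_funM => //.
  by apply: measurable_funD => //; apply: measurable_funM.
- move=> w; apply: addr_ge0 => //; apply: mulr_ge0 => //.
  by have := W_ge0 w; lra.
- move=> f w Ff; apply: (le_trans (dev_le w Ff)).
  pose x l := rt l * s l (rho l f).
  have x0 l : 0 <= x l by exact: x_ge0.
  have xG : \sum_(l < n.+1) x l <= G by exact: s_sum.
  have Nx l : 2 * N * \int[P]_u rem l f u <= 2 * c * x l.
    apply: (@le_trans _ _ (2 * N * (x l / Num.sqrt nR))).
      by apply: ler_wpM2l; [rewrite mulr_ge0|exact: integral_rem].
    apply: (@le_trans _ _ (2 * (nR * nR) * (x l / Num.sqrt nR))).
      by apply: ler_wpM2r; [rewrite divr_ge0// ltW|rewrite ler_pM2l].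
    rewrite /c -[X in 2 * (_ * X) * _](sqr_sqrtr (ltW nR_gt0)) le_eqVlt.
    by apply/orP; left; apply/eqP; field; rewrite gt_eqF.
  have nuE l : nu l f = 2 * c * x l by rewrite /nu /c /x; ring.
  have last_le : 2 * N * thr n (rho n f) <= 2 * c * x n.
    (* This inequality is what depth [n] buys: it compares the final threshold, summed over all
       dyads, with the last term of the series. *)
    have n2n : nR - 1 <= rt n ^+ 2.
      rewrite rt_sqr lerBlDr (_ : 2 ^+ n = (2 ^ n)%N%:R) -?natrX// natr1 ler_nat.
      by rewrite leqW// ltnW// ltn_expl.
    rewrite NE /thr /c /x.
    have -> : 2 * (nR * Num.sqrt nR) * (rt n * s n (rho n f)) =
      2 * (nR * rt n ^+ 2) * (Num.sqrt nR * s n (rho n f) / rt n).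
      by field; rewrite gt_eqF.
    apply: ler_wpM2r; last by rewrite !ler_pM2l.
    by rewrite divr_ge0 ?mulr_ge0// ltW// s_gt0//; exact: rhoF.
  have sumI : \sum_(l < n) Y (incr l f) w <= 2 * c * (8 + 2 * W w) * \sum_(l <
    n) x l.
    rewrite mulr_sumr; apply: ler_sum => l _.
    have [+ _] := @dev_incr_rem l f w (ltn_ord l) Ff.
    by move=> /le_trans; apply; rewrite nuE mulrAC.
  have sumR : \sum_(l < n) Y (rem l.+1 f) w <= 2 * c * (8 + 2 * W w) * \sum_(l
    < n) x l.
    rewrite mulr_sumr; apply: ler_sum => l _.
    have [_ +] := @dev_incr_rem l f w (ltn_ord l) Ff.
    by move=> /le_trans; apply; rewrite nuE mulrAC.
  have sumx : \sum_(l < n) x l <= G.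
    by apply: le_trans xG; rewrite big_ord_recr/= lerDl.
  have sumxS : \sum_(l < n) x l.+1 <= G.
    by apply: le_trans xG; rewrite big_ord_recl/= lerDr.
  have xn : x n <= G.
    by apply: le_trans xG; rewrite big_ord_recr/= lerDr sumr_ge0.
  have x0G : x 0%N <= G.
    by apply: le_trans xG; rewrite big_ord_recl/= lerDl sumr_ge0.
  have sumN : \sum_(l < n) 2 * N * \int[P]_u rem l.+1 f u <= 2 * c * \sum_(l <
    n) x l.+1.
    by rewrite mulr_sumr; apply: ler_sum => l _; exact: Nx.
  have W0 := W_ge0 w.
  have cW : 0 <= c * (8 + 2 * W w) by apply: mulr_ge0; [exact: ltW|lra].
  have m1 := ler_wpM2l cW sumx.
  have m2 := ler_wpM2l (ltW c_gt0) sumxS.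
  have m3 := ler_wpM2l (ltW c_gt0) xn.
  have m4 := ler_wpM2l (ltW c_gt0) x0G.
  have YV : Y (rem 0%N f) w + 2 * N * \int[P]_u rem 0%N f u <= V w + c * x 0%N.
    rewrite (rem0 Ff) /Y /deviation sumrB sumr_const -(mulr_natl (\int[P]_u _)) -/N.
    by have := Nx 0%N; rewrite (rem0 Ff) /V; lra.
  rewrite [X in _ + X + _]big_ord_recl/= [X in _ + (_ + X) + _]big_split/=.
  move: (\int[P]_u rem 0%N f u) YV => I0 YV.
  rewrite /bump/=; move: sumI sumR sumN; rewrite /bump/=.
  set S1 := \sum_(_ < _) Y (incr _ _) _; set S2 := \sum_(_ < _) Y _ _.
  set S3 := \sum_(_ < _) 2 * _ * _.
  move=> hI hR hN; lra.
- under eq_integral do rewrite EFinD.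
  rewrite ge0_integralD//; last 4 first.
  - by move=> w _; rewrite lee_fin mulr_ge0//; have := W_ge0 w; lra.
  - by apply/measurable_EFinP; apply: measurable_funM => //; apply:
    measurable_funD => //; apply: measurable_funM.
  - by move=> w _; rewrite lee_fin.
  - exact/measurable_EFinP.
  rewrite Vmean.
  have rem0_le : N * \int[P]_u rem 0%N (cst 0) u <= c * G.
    pose x l := rt l * s l (rho l (cst 0)).
    have x0 l : 0 <= x l by exact: x_ge0.
    have xG : \sum_(l < n.+1) x l <= G by exact: s_sum.
    have x0G : x 0%N <= G.
      by apply: le_trans xG; rewrite big_ord_recl/= lerDl sumr_ge0.
    apply: (@le_trans _ _ (nR * nR * (x 0%N / Num.sqrt nR))).
      apply: (le_trans (ler_wpM2l N_ge0 (integral_rem 0%N F0))).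
      apply: ler_wpM2r; last exact: N_le.
      apply: divr_ge0; [exact: x0|exact: ltW].
    have -> : nR * nR * (x 0%N / Num.sqrt nR) = c * x 0%N.
      rewrite /c -{2}(sqr_sqrtr (ltW nR_gt0)); field; rewrite gt_eqF//.
    by rewrite ler_pM2l.
  apply: (@le_trans _ _ ((37 * (c * G))%:E + (8 * (c * G))%:E * 4%:E +
      (c * G)%:E)%E); last first.
    by rewrite -EFinM -!EFinD lee_fin -/nR -/c; lra.
  apply: leeD; last by rewrite lee_fin.
  have k0 : 0 <= 8 * (c * G) by rewrite mulr_ge0.
  apply: (@le_trans _ _ ((37 * (c * G))%:E + (8 * (c * G))%:E * \int[Pr]_x (W
    x)%:E)%E); last first.
    by rewrite leeD2l// lee_wpmul2l.
  rewrite -ge0_integralZl//; last 2 first.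
  - exact/measurable_EFinP.
  - by move=> w _; rewrite lee_fin.
  rewrite -[X in (X + _)%E](_ : (\int[Pr]_x (cst (37 * (c * G))%:E) x)%E = _);
    last first.
    by rewrite integral_cst// [X in (_ * X)%E](probability_setT Pr) mule1.
  rewrite -ge0_integralD//; last 3 first.
  - by move=> w _; rewrite /= lee_fin mulr_ge0.
  - by move=> w _; apply: mule_ge0; rewrite lee_fin.
  - by apply: measurable_funeM; exact/measurable_EFinP.
  rewrite le_eqVlt; apply/orP; left; apply/eqP; apply: eq_integral => w _.
  by rewrite /= -EFinM -EFinD; congr EFin; ring.
Qed.

End chaining.

(** * Complexities *)

Section blocks.
Context (R : realType) (U : Type) (Fc : set (U -> R)).
Variable T : nat -> set (set (U -> R)).
Hypothesis T_part : forall l, partition (T l) id Fc.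
Hypothesis T_refine : forall l A, T l.+1 A -> exists2 B, T l B & A `<=` B.

Definition block l (f : U -> R) : set (U -> R) := pblock (T l) id f.

Lemma blockP l f : Fc f -> T l (block l f) /\ block l f f.
Proof.
move=> Ff; have [TF _ _] := T_part l; move: (Ff); rewrite -TF => -[A TA Af].
rewrite /block /pblock /pblock_index.
by apply: (@getPex _ (fun A => T l A /\ A f)); exists A.
Qed.

Lemma block_sub l f : Fc f -> block l f `<=` Fc.
Proof.
move=> Ff h bh; have [TF _ _] := T_part l; rewrite -TF.
by exists (block l f) => //; have [] := blockP l Ff.
Qed.

Lemma block_unique l A f : T l A -> A f -> block l f = A.
Proof.
move=> TA Af; have [TF tri _] := T_part l.
have Ff : Fc f by rewrite -TF; exists A.
have [TB Bf] := blockP l Ff.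
by apply: tri => //; exists f.
Qed.

Lemma block_eq l f h : Fc f -> block l f h -> block l h = block l f.
Proof. by move=> Ff; apply: block_unique; have [] := blockP l Ff. Qed.

Lemma block_mono j l f : (j <= l)%N -> Fc f -> block l f `<=` block j f.
Proof.
move=> + Ff; elim: l => [|l IH]; first by rewrite leqn0 => /eqP ->.
rewrite leq_eqVlt => /predU1P[->//|]; rewrite ltnS => jl h bh.
apply: IH => //; have [TS bS] := blockP l.+1 Ff.
have [B TB SB] := T_refine TS.
by rewrite (block_unique TB (SB _ bS)); exact: SB.
Qed.

(* The zero function represents its own block, so that chains start at 0. *)
Definition rep (A : set (U -> R)) : U -> R :=
  if pselect (A (cst 0)) then cst 0 else get A.

Lemma repP A f : A f -> A (rep A).
Proof.
by move=> Af; rewrite /rep; case: pselect => [A0|nA0]; [exact: A0|exact: getI Af].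
Qed.

Lemma rep_block_in l f : Fc f -> block l f (rep (block l f)).
Proof. by move=> Ff; have [_ bf] := blockP l Ff; exact: repP bf. Qed.

Lemma rep_block_F l f : Fc f -> Fc (rep (block l f)).
Proof. by move=> Ff; apply: (block_sub Ff); exact: rep_block_in. Qed.

Lemma block_rep j l f : (j <= l)%N -> Fc f ->
  block j (rep (block l f)) = block j f.
Proof.
by move=> jl Ff; apply: block_eq => //; apply: (block_mono jl Ff); exact:
  rep_block_in.
Qed.

Lemma block_width_ub l f h h' u : block l f h -> block l f h' ->
  (`|h u - h' u|%:E <= block_width f (T l) u)%E.
Proof. by move=> bh bh'; apply: ereal_sup_ubound; exists (h, h'). Qed.

Lemma block_width_rep l f : Fc f ->
  block_width (rep (block l f)) (T l) = block_width f (T l).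
Proof.
move=> Ff; have := @block_rep l l f (leqnn l) Ff.
by rewrite /block_width /block => ->.
Qed.

Lemma block_enum l m : (T l #= `I_m)%card -> exists e : nat -> set (U -> R),
  (forall i, (i < m)%N -> T l (e i)) /\
  (forall f, Fc f -> exists2 i, (i < m)%N & block l f = e i).
Proof.
rewrite card_eq_sym => /pcard_eqP/unsquash e; exists e; split => [i im|f Ff].
  exact: funS.
have [TB _] := blockP l Ff.
by have [i im <-] := @surj _ _ _ _ e _ TB; exists i.
Qed.

End blocks.

(** * From L^(2p) norms to second moments *)

Section majorants.
Context (R : realType) d (U : measurableType d) (P : probability U R).

(** Applied to [t = g / s], this stands in for Hölder's inequality: after integration each of the
    two terms contributes at most [s ^ 2]. *)
Lemma sqr_le_powR (t q : R) : 0 <= t -> 2 <= q -> t ^+ 2 <= 1 + t `^ q.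
Proof.
move=> t0 q2; have [t1|t1] := leP t 1.
  have := exprn_ile1 2 t0 t1; have := powR_ge0 t q; lra.
rewrite -powR_mulrn//; apply: (@le_trans _ _ (t `^ q)); last by lra.
by apply: ler_powR => //; exact: ltW.
Qed.

(* Comparing L^2 with L^q up to the factor 2, which absorbs the truncation. *)
Lemma integral_sqr_truncated (h : U -> \bar R) (q s Mb : R) :
  2 <= q -> 0 < s -> 0 <= Mb -> measurable_fun setT h ->
  (forall u, 0 <= h u)%E -> ('N[P]_q%:E[h] < s%:E)%E ->
  \int[P]_u (fine (Order.min (h u) Mb%:E) ^+ 2) <= (2 * s) ^+ 2.
Proof.
move=> q2 s0 M0 mh h0 hs; pose g u := fine (Order.min (h u) Mb%:E).
have q0 : 0 < q by lra.
have gE u : (g u)%:E = Order.min (h u) Mb%:E.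
  rewrite /g fineK// ge0_fin_numE ?le_min ?h0 ?lee_fin//.
  by rewrite gt_min ltry orbT.
have g0 u : 0 <= g u by rewrite -lee_fin gE le_min h0 lee_fin.
have gM u : g u <= Mb by rewrite -lee_fin gE ge_min lexx orbT.
have mg : measurable_fun setT g.
  by apply/measurable_EFinP; rewrite (_ : _ \o _ = fun u => Order.min (h u) Mb%:E);
    [exact: measurable_mine|exact/funext].
have Ilt : (\int[P]_u (`|h u| `^ q) <= (s `^ q)%:E)%E.
  rewrite -poweR_Lnorm ?gt_eqF// -poweR_EFin; apply: gt0_ler_poweR; rewrite
    ?(ltW q0)//.
  - by rewrite in_itv/= Lnorm_ge0 leey.
  - by rewrite in_itv/= lee_fin (ltW s0) leey.
  - exact: ltW.
have mhq : measurable_fun setT (fun u => (`|h u| `^ q)%E).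
  by apply: (measurableT_comp (measurable_poweR _)); exact: measurableT_comp.
have ig : P.-integrable setT (EFin \o (fun u => g u ^+ 2)).
  apply: (@integrable_bounded _ _ _ _ _ (Mb ^+ 2)); first exact: measurable_funX.
  by move=> u; rewrite ger0_norm ?sqr_ge0// lerXn2r// ?nnegrE.
have k0 : 0 <= s ^+ 2 * (s^-1) `^ q by rewrite mulr_ge0 ?sqr_ge0// powR_ge0.
have kE : s ^+ 2 * (s^-1) `^ q * s `^ q = s ^+ 2.
  by rewrite -mulrA -powRM ?invr_ge0 ?(ltW s0)// mulVf ?gt_eqF// powR1 mulr1.
rewrite -lee_fin -/(Rintegral P setT (fun u => g u ^+ 2)) /Rintegral.
rewrite fineK; last exact: integrable_fin_num.
apply: (@le_trans _ _ (\int[P]_u ((s ^+ 2)%:E + (s ^+ 2 * (s^-1) `^ q)%:E *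
  (`|h u| `^ q)))%E).
  apply: ge0_le_integral => //.
  - by move=> u _; rewrite lee_fin sqr_ge0.
  - by apply/measurable_EFinP; exact: measurable_funX.
  - by apply: emeasurable_funD => //; apply: measurable_funeM.
  move=> u _; apply: (@le_trans _ _ ((s ^+ 2)%:E + (s ^+ 2 * (s^-1) `^ q)%:E *
    (g u `^ q)%:E)%E).
    rewrite -EFinM -EFinD lee_fin -mulrA -powRM ?invr_ge0 ?(ltW s0)//.
    have -> : g u ^+ 2 = s ^+ 2 * (s^-1 * g u) ^+ 2 by rewrite exprMn exprVn
      mulrA divff ?mul1r// expf_neq0// gt_eqF.
    rewrite -[X in X + _]mulr1 -mulrDr ler_wpM2l ?sqr_ge0// sqr_le_powR//.
    by rewrite mulr_ge0// invr_ge0 ltW.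
  rewrite leeD2l// lee_wpmul2l// -poweR_EFin.
  apply: gt0_ler_poweR; rewrite ?(ltW q0) ?in_itv/= ?leey ?andbT ?lee_fin//.
  by rewrite gee0_abs// gE ge_min lexx.
rewrite ge0_integralD//; last 3 first.
- by move=> u _; rewrite lee_fin sqr_ge0.
- by move=> u _; rewrite mule_ge0// poweR_ge0.
- exact: measurable_funeM.
rewrite integral_cst// [X in (_ * X + _)%E](probability_setT P) mule1
  ge0_integralZl//;
  last by move=> u _; exact: poweR_ge0.
apply: (@le_trans _ _ ((s ^+ 2)%:E + (s ^+ 2 * (s^-1) `^ q)%:E * (s `^ q)%:E)%E).
  by rewrite leeD2l// lee_wpmul2l.
rewrite -EFinM kE -EFinD lee_fin exprMn; have := sqr_ge0 s; lra.
Qed.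

End majorants.

(** * From a partition sequence to chain data *)

Section generic_chaining.
Context (R : realType) d (T : measurableType d) (Pr : probability T R).
Context (n : nat) dM (M : measurableType dM) dE (E : measurableType dE).
Variables (mu : 'I_n -> {mfun T >-> M}) (eps : dyad n -> {mfun T >-> E}).
Hypothesis iid : iid_inputs Pr mu eps.
Context d' (U : measurableType d') (F : {mfun (M * M * E)%type >-> U}).
Variable P : probability U R.
Hypothesis law : forall (k : dyad n) (A : set U), measurable A ->
  P A = Pr (dyadic_data mu eps F k @^-1` A).
Hypothesis n2 : (2 <= n)%N.
Variable Fc : set (U -> R).
Hypothesis mF : forall f, Fc f -> measurable_fun setT f.
Hypothesis F0 : Fc (cst 0).
Variable Mb : R.
Hypothesis F_bounded : forall f f' u, Fc f -> Fc f' -> `|f u - f' u| <= Mb.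

(** For [a >= 1] the exponent [2 ^ (l / a)] is at most [2 ^ l], so every such order meets
    Talagrand's usual cardinality bound. This keeps the constant independent of [a]. *)
Lemma admissible_card (a : R) (S : nat -> set (set (U -> R))) : 1 <= a ->
  admissible a Fc S -> forall l, exists2 m, (S l #= `I_m)%card & (m <= 2 ^ (2 ^
    l))%N.
Proof.
move=> a1 [_ _ S0 Sl] [|l]; first by exists 1%N.
have [m mS mle] := Sl l.+1 isT; exists m => //.
rewrite -(ler_nat R) natrX; apply: (le_trans mle).
rewrite -[leRHS]powR_mulrn//; apply: ler_powR; first by rewrite ler1n.
rewrite natrX -[leRHS]powR_mulrn//; apply: ler_powR; first by rewrite ler1n.
by rewrite ler_pdivrMr ?(lt_le_trans ltr01)// ler_peMr.
Qed.

Lemma sqrt_expr2 l : Num.sqrt (2 ^+ l) = 2 `^ (l%:R / 2) :> R.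
Proof.
by rewrite -powR12_sqrt ?exprn_ge0// -powR_mulrn// -powRrM.
Qed.

Lemma sup_deviation_le (p a G e : R) (S : nat -> set (set (U -> R))) :
  1 < p -> 1 <= a -> admissible a Fc S -> 0 < e ->
  (forall f, Fc f -> (\sum_(0 <= l <oo)
      (2 `^ (l%:R / 2))%:E * outer_Lnorm P (2 * p)%:E (block_width f (S l)) <=
        G%:E)%E) ->
  exists B : T -> R,
  [/\ measurable_fun setT B, (forall w, 0 <= B w),
      (forall f w, Fc f -> deviation mu eps F P f w <= B w) &
      (\int[Pr]_w (B w)%:E <= (140 * (n%:R * Num.sqrt n%:R) * (G + e))%:E)%E].
Proof.
move=> p1 a1 adm e0 sumG; have S_card := admissible_card a1 adm.
have [S_part S_refine S0 _] := adm.
have Mb0 : 0 <= Mb by apply: le_trans (F_bounded point F0 F0).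
pose nm l f := outer_Lnorm P (2 * p)%:E (block_width f (S l)).
have nm0 l f : (0 <= nm l f)%E.
  by apply: le_ereal_inf_tmp => _ [h _ <-]; exact: Lnorm_ge0.
have rt0 l : 0 < 2 `^ (l%:R / 2) :> R by exact: powR_gt0.
have partial f k : Fc f -> (\sum_(0 <= l < k) (2 `^ (l%:R / 2))%:E * nm l f <=
  G%:E)%E.
  move=> Ff; apply: le_trans (sumG f Ff); apply: nneseries_lim_ge => l _ _.
  by rewrite mule_ge0// lee_fin ltW.
have nm_fin l f : Fc f -> nm l f \is a fin_num.
  move=> Ff; rewrite ge0_fin_numE//.
  have := partial f l.+1 Ff; rewrite big_nat_recr//= => h.
  rewrite ltey; apply/eqP => nmoo; move: h; rewrite nmoo gt0_muley ?lte_fin//.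
  rewrite addey ?leye_eq// -ltNye (@lt_le_trans _ _ 0%E)// sume_ge0// => i _.
  by rewrite mule_ge0// lee_fin ltW.
pose rho l f := rep (block S l f).
have rhoF l f : Fc f -> Fc (rho l f) by move=> Ff; exact: rep_block_F.
have nm_rho l f : Fc f -> nm l (rho l f) = nm l f.
  by move=> Ff; rewrite /nm (@block_width_rep _ _ Fc).
(* Exceeding the outer norm strictly produces a measurable majorant of the block width and makes the
   scale positive. Weighted by [2 ^ (l / 2)], the excesses of the [n + 1] levels add up to exactly
   [e]. *)
pose s' l f := fine (nm l f) + e / (n.+1%:R * 2 `^ (l%:R / 2)).
have s'0 l f : 0 < s' l f.
  by rewrite ltr_wpDl ?fine_ge0// divr_gt0// mulr_gt0// ltr0n.
have major l f : Fc f -> exists h : U -> R,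
    [/\ measurable_fun setT h, forall u, 0 <= h u <= Mb,
     forall f1 f2 u, block S l f f1 -> block S l f f2 -> `|f1 u - f2 u| <= h u &
     \int[P]_u (h u ^+ 2) <= (2 * s' l f) ^+ 2].
  move=> Ff; have nmlt : (nm l f < (s' l f)%:E)%E.
    rewrite /s' EFinD fineK ?nm_fin// lteDl ?nm_fin// lte_fin divr_gt0// mulr_gt0//.
  have [_ [h [mh hD] <-] hlt] := ereal_inf_lt nmlt.
  have h0 u : (0 <= h u)%E by apply: le_trans (hD u); exact: abse_ge0.
  have hfin u : Order.min (h u) Mb%:E \is a fin_num.
    rewrite ge0_fin_numE ?le_min ?h0 ?lee_fin//.
    by rewrite gt_min ltry orbT.
  (* Cutting at the diameter bound [Mb] makes the majorant finite and bounded, yet it still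
     dominates all differences within the block. *)
  exists (fun u => fine (Order.min (h u) Mb%:E)); split.
  - apply/measurable_EFinP; rewrite (_ : _ \o _ = fun u => Order.min (h u) Mb%:E);
      [exact: measurable_mine|by apply/funext => u /=; rewrite fineK].
  - move=> u; rewrite fine_ge0 ?le_min ?h0 ?lee_fin//=.
    by rewrite -lee_fin fineK// ge_min lexx orbT.
  - move=> f1 f2 u b1 b2; rewrite -lee_fin fineK// le_min; apply/andP; split.
      apply: le_trans (hD u); apply: le_trans (lee_abs _).
      exact: block_width_ub.
    by rewrite lee_fin F_bounded//; [exact: (block_sub S_part Ff b1)|exact:
      (block_sub S_part Ff b2)].
  - by apply: (integral_sqr_truncated (q := 2 * p)) => //; lra.
(* Choice asks for a function at every pair, so membership in the class becomes a premise and any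
   function serves outside it. *)
pose Q (lf : nat * (U -> R)) (h : U -> R) := Fc lf.2 ->
    [/\ measurable_fun setT h, forall u, 0 <= h u <= Mb,
     forall f1 f2 u, block S lf.1 lf.2 f1 -> block S lf.1 lf.2 f2 -> `|f1 u -
       f2 u| <= h u &
     \int[P]_u (h u ^+ 2) <= (2 * s' lf.1 lf.2) ^+ 2].
have exQ lf : exists h, Q lf h.
  case: lf => l f; have [Ff|nF] := pselect (Fc f); last by exists (cst 0).
  by have [h hP] := major l f Ff; exists h.
have [g gP] := choice exQ.
have exm l : exists m, (S l #= `I_m)%card /\ (m <= 2 ^ (2 ^ l))%N.
  by have [m h1 h2] := S_card l; exists m.
have [m mP] := choice exm.
have [en enP] := choice (fun l => block_enum S_part (proj1 (mP l))).
have block_rho l f : Fc f -> block S l f (rho l f).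
  by move=> Ff; exact: rep_block_in.
(* The factor 2 in the scales comes from passing from L^(2p) to L^2; it turns 70 into 140. *)
have [] := @chaining_bound R d T Pr n dM M dE E mu eps iid d' U F P law n2 Fc rho
  (fun l f => g (l, f)) (fun l f => 2 * s' l f) Mb (2 * (G + e)) m
  (fun l i => rep (en l i)).
- exact: mF.
- exact: rhoF.
- by move=> j l f jl Ff; rewrite /rho (block_rep S_part S_refine jl Ff).
- exact: F0.
(* Level 0 has a single block, which contains the zero function, and [rep] then selects zero. *)
- move=> f Ff; rewrite /rho /rep.
  have [_ b0] := blockP S_part 0%N F0.
  have [e' [_ e'P]] := block_enum S_part S0.
  have [[|//] _ bf] := e'P f Ff; have [[|//] _ b00] := e'P _ F0.
  by case: pselect => // -[]; rewrite bf -b00.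
- move=> l f f' u Ff Ff' rr.
  have [_ _ gd _] := gP (l, rho l f) (rhoF l f Ff).
  apply: gd => /=; rewrite [block S l (rho l f)](block_rep S_part S_refine
    (leqnn l) Ff).
    by have [] := blockP S_part l Ff.
  rewrite -[block S l f](block_rep S_part S_refine (leqnn l) Ff) -/(rho l f) rr.
  rewrite [block S l (rho l f')](block_rep S_part S_refine (leqnn l) Ff').
  by have [] := blockP S_part l Ff'.
- by move=> l f Ff; have [] := gP (l, f) Ff.
- by move=> l f u Ff; have [_ /(_ u)/andP[]] := gP (l, f) Ff.
- by move=> l f u Ff; have [_ /(_ u)/andP[]] := gP (l, f) Ff.
- by move=> l f Ff; have [] := gP (l, f) Ff.
- by move=> l f Ff; rewrite mulr_gt0.
- move=> l f Ff; have [_ /(_ f Ff)[i im bi]] := enP l.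
  by exists i => //; rewrite /rho bi.
- move=> l i im; have [/(_ i im) Sei _] := enP l.
  have [SF _ /(_ _ Sei)[f ef]] := S_part l.
  by rewrite -SF; exists (en l i) => //=; exact: (repP ef).
- by move=> l; have [] := mP l.
- move=> f Ff.
  have -> : \sum_(l < n.+1) Num.sqrt (2 ^+ l) * (2 * s' l (rho l f)) =
      2 * (\sum_(l < n.+1) 2 `^ (l%:R / 2) * fine (nm l f) + e).
    have eE : e = \sum_(l < n.+1) e / n.+1%:R.
      by rewrite sumr_const card_ord -[RHS]mulr_natr divfK// pnatr_eq0.
    rewrite [in RHS]eE -big_split/= mulr_sumr; apply: eq_bigr => l _.
    rewrite /s' (nm_rho _ _ Ff) sqrt_expr2 invfM; field.
    by rewrite ?pnatr_eq0 ?gt_eqF.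
  rewrite ler_pM2l// lerD2r -lee_fin -sumEFin.
  apply: le_trans (partial f n.+1 Ff); rewrite big_mkord; apply: lee_sum => l _.
  by rewrite EFinM fineK ?nm_fin.
move=> B [mB B0 dB iB]; exists B; split => //; apply: (le_trans iB).
by rewrite lee_fin; lra.
Qed.

End generic_chaining.

(** * Consequences of a finite complexity *)

Section complexity.
Context (R : realType) (U : Type) (Fc : set (U -> R)).
Hypothesis F0 : Fc (cst 0).

Lemma gamma_complexity_ge0 (q s : R) (nm : (U -> \bar R) -> \bar R) :
  (forall h, 0 <= nm h)%E -> (0 <= gamma_complexity q s Fc nm)%E.
Proof.
move=> nm0; apply: le_ereal_inf_tmp => _ [T _ <-].
apply: le_trans (ereal_sup_ubound (imageP _ F0)).
by apply: nneseries_ge0 => l _ _; rewrite mule_ge0// lee_fin powR_ge0.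
Qed.

Lemma gamma_complexity_lt (q s x : R) (nm : (U -> \bar R) -> \bar R) :
  (gamma_complexity q s Fc nm < x%:E)%E -> exists2 T, admissible s Fc T &
  forall f, Fc f -> (\sum_(0 <= l <oo)
    (2 `^ (l%:R / q))%:E * nm (block_width f (T l)) <= x%:E)%E.
Proof.
move=> /ereal_inf_lt[_ [T aT <-] /ltW Tx]; exists T => // f Ff.
by apply: le_trans Tx; apply: ereal_sup_ubound; exists f.
Qed.

Lemma sup_norm_ge0 (u0 : U) (h : U -> \bar R) : (0 <= sup_norm h)%E.
Proof.
by apply: le_trans (ereal_sup_ubound (imageP _ (I : [set: U] u0))).
Qed.

(* Since [T 0] has a single block, the level 0 term of the complexity for the
   supremum norm dominates the diameter of the whole class. *)
Lemma gamma_complexity_bounded (u0 : U) (q s : R) :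
  (gamma_complexity q s Fc (@sup_norm R U) < +oo)%E ->
  exists K, forall f f' u, Fc f -> Fc f' -> `|f u - f' u| <= K.
Proof.
move=> goo.
have g0 : (0 <= gamma_complexity q s Fc (@sup_norm R U))%E.
  by apply: gamma_complexity_ge0 => h; exact: sup_norm_ge0.
have glt : (gamma_complexity q s Fc (@sup_norm R U) <
    (fine (gamma_complexity q s Fc (@sup_norm R U)) + 1)%:E)%E.
  by rewrite EFinD fineK ?ge0_fin_numE// lteDl ?ge0_fin_numE// lte01.
have [T [T_part T_refine T0 _] TK] := gamma_complexity_lt glt.
exists (fine (gamma_complexity q s Fc (@sup_norm R U)) + 1) => f f' u Ff Ff'.
rewrite -lee_fin; apply: le_trans (TK _ F0).
apply: le_trans (nneseries_lim_ge 1%N _); last first.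
  by move=> l _ _; rewrite mule_ge0 ?sup_norm_ge0// lee_fin powR_ge0.
rewrite big_nat1 mul0r powRr0 mul1e.
have [e' [_ e'P]] := block_enum T_part T0.
have in0 h : Fc h -> block T 0%N (cst 0) h.
  move=> Fh; have [[|//] _ bh] := e'P h Fh; have [[|//] _ b0] := e'P _ F0.
  by rewrite b0 -bh; have [] := blockP T_part 0%N Fh.
apply: le_trans (ereal_sup_ubound (imageP _ (I : [set: U] u))).
by apply: le_trans (lee_abs _); apply: block_width_ub; exact: in0.
Qed.

End complexity.

(** * The supremum of the empirical process *)

Theorem proposition3 (R : realType) :
  exists2 C : R, 0 < C &
  forall (n : nat) (p a b : R)
    (dO dM dE : measure_display)
    (Omega : measurableType dO) (M : measurableType dM) (E : measurableType dE)
    (Z : completePseudoMetricType R)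
    (Pr : probability Omega R)
    (mu : 'I_n -> {mfun Omega >-> M}) (eps : dyad n -> {mfun Omega >-> E})
    (F : {mfun (M * M * E)%type >-> borel Z})
    (P : probability (borel Z) R)
    (Fc : set (borel Z -> R)),
  (2 <= n)%N -> 1 < p -> 1 <= a -> 1 <= b ->
  polish_space Z ->
  iid_inputs Pr mu eps ->
  (forall (ij : dyad n) (A : set (borel Z)), measurable A ->
    P A = Pr (dyadic_data mu eps F ij @^-1` A)) ->
  (forall f, Fc f -> measurable_fun setT f) ->
  Fc (cst 0) ->
  (outer_Lnorm Pr 1 (fun w => ereal_sup
     [set (empirical_process Pr (dyadic_data mu eps F) f w)%:E | f in Fc])
   <= C%:E *
      ((Num.sqrt n%:R)%:E *
         gamma_complexity 2 a Fc (outer_Lnorm P (2 * p)%:E) +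
       ((Num.sqrt n%:R)^-1)%:E *
         gamma_complexity 1 b Fc (@sup_norm R (borel Z))))%E.
Proof.
(* 280 is 140 times the 2 of [n <= 2 sqrt (n (n - 1))], which holds from [n = 2] on. *)
have [C C0 CE] : exists2 C : R, 0 < C & C = 280 by exists 280; rewrite ?ltr0n.
exists C => //.
move=> n p a b dO dM dE Omega M E Z Pr mu eps F P Fc n2 p1 a1 b1 _ iid law mF F0.
set g2 := gamma_complexity 2 a Fc _; set g1 := gamma_complexity 1 b Fc _.
have g20 : (0 <= g2)%E.
  by apply: gamma_complexity_ge0 => // h; apply: le_ereal_inf_tmp => _ [g _
    <-]; exact: Lnorm_ge0.
have g10 : (0 <= g1)%E.
  by apply: gamma_complexity_ge0 => // h; exact: (sup_norm_ge0 point).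
have n0 : (0 < n)%N by exact: leq_trans n2.
have sn0 : 0 < Num.sqrt n%:R :> R by rewrite sqrtr_gt0 ltr0n.
have [g1oo|g1oo] := eqVneq g1 +oo%E.
  rewrite g1oo gt0_muley ?lte_fin ?invr_gt0// addey; last first.
    by rewrite -ltNye (@lt_le_trans _ _ 0%E)// mule_ge0// lee_fin ltW.
  by rewrite gt0_muley ?lte_fin// leey.
have [g2oo|g2oo] := eqVneq g2 +oo%E.
  rewrite g2oo gt0_muley ?lte_fin// addye; last first.
    by rewrite -ltNye (@lt_le_trans _ _ 0%E)// mule_ge0// lee_fin invr_ge0 ltW.
  by rewrite gt0_muley ?lte_fin// leey.
have [K FK] : exists K, forall f f' u, Fc f -> Fc f' -> `|f u - f' u| <= K.
  by apply: (gamma_complexity_bounded F0 point (q := 1) (s := b)); rewrite ltey.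
apply: (@le_trans _ _ (C%:E * ((Num.sqrt n%:R)%:E * g2)))%E; last first.
  by rewrite lee_wpmul2l ?lee_fin ?(ltW C0)// leeDl// mule_ge0// lee_fin
    invr_ge0 ltW.
have g2fin : g2 \is a fin_num by rewrite ge0_fin_numE// ltey.
rewrite -(fineK g2fin) -!EFinM; apply/lee_addgt0Pr => e e0.
(* Spent twice: on a nearly optimal partition sequence, and on the excess over the outer norms in
   [sup_deviation_le]. *)
pose e' := e / (2 * C * Num.sqrt n%:R).
have e'0 : 0 < e' by apply: divr_gt0 => //; do 2 apply: mulr_gt0 => //.
have glt : (g2 < (fine g2 + e')%:E)%E by rewrite EFinD fineK// lteDl.
have [S aS SK] := gamma_complexity_lt glt.
have [B [mB B0 dB iB]] := sup_deviation_le iid law n2 mF F0 FK p1 a1 aS e'0 SK.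
have N0 : 0 < #|{: dyad n}|%:R :> R by rewrite ltr0n card_dyad muln_gt0 n0
  -subn1 subn_gt0.
have sN0 : 0 < Num.sqrt #|{: dyad n}|%:R :> R by rewrite sqrtr_gt0.
(* Functions of the class are bounded by [K], hence integrable: the centering is a genuine mean and
   equals the integral under [P]. *)
have procE f w : Fc f -> empirical_process Pr (dyadic_data mu eps F) f w =
    (Num.sqrt #|{: dyad n}|%:R)^-1 * deviation mu eps F P f w.
  move=> Ff; rewrite /empirical_process /deviation; congr (_ * _).
  apply: eq_bigr => k _; congr (_ - _).
  rewrite unlock.
  pose X' : {mfun Omega >-> borel Z} := HB.pack (dyadic_data mu eps F k)
    (isMeasurableFun.Build _ _ _ _ (dyadic_data mu eps F k)
      (measurable_dyadic_data mu eps F k)).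
  have fK u : `|f u| <= K by rewrite -[f u]subr0; exact: (FK f (cst 0)).
  rewrite /Rintegral; congr fine.
  transitivity (\int[distribution Pr X']_u (f u)%:E)%E.
    rewrite integral_distribution//; first by apply/measurable_EFinP; exact: mF.
    apply: (@integrable_bounded _ _ _ Pr _ K) => [|v]; last exact: fK.
    by apply: measurableT_comp; [exact: mF|exact: measurable_dyadic_data].
  by apply: eq_measure_integral => A mA _; exact/esym/law.
pose H w := ((Num.sqrt #|{: dyad n}|%:R)^-1 * B w)%:E.
have mH : measurable_fun setT H by apply/measurable_EFinP; exact: measurable_funM.
apply: (@le_trans _ _ ('N[Pr]_1[H])%E).
  apply: ereal_inf_lbound; exists H => //; split => // w.
  (* The zero function makes the supremum nonnegative, so a one-sided bound controls its absolute
     value. *)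
  rewrite gee0_abs; last first.
    apply: le_trans (ereal_sup_ubound (imageP _ F0)).
    rewrite lee_fin /empirical_process big1 ?mulr0// => k _.
    by rewrite unlock /= integral_cst// mul0e subr0.
  apply: ub_ereal_sup => _ [f Ff <-].
  by rewrite lee_fin procE// ler_wpM2l// ?invr_ge0 ?(ltW sN0)//; exact: dB.
rewrite Lnorm1.
under eq_integral => w _ do rewrite /H gee0_abs ?lee_fin ?mulr_ge0 ?invr_ge0
  ?(ltW sN0)// EFinM.
rewrite ge0_integralZl//; last 2 first.
- exact/measurable_EFinP.
- by move=> w _; rewrite lee_fin.
apply: (@le_trans _ _ ((Num.sqrt #|{: dyad n}|%:R)^-1%:E *
   (140 * (n%:R * Num.sqrt n%:R) * (fine g2 + e'  + e'))%:E)%E).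
  by apply: lee_wpmul2l => //; rewrite lee_fin invr_ge0 ltW.
rewrite -EFinM -EFinD lee_fin mulrC ler_pdivrMr//.
have sNn : n%:R <= 2 * Num.sqrt #|{: dyad n}|%:R :> R.
  have n1 : 2 <= n%:R :> R by rewrite ler_nat.
  rewrite -(@ler_pXn2r _ 2)// ?nnegrE ?mulr_ge0// exprMn sqr_sqrtr//.
  rewrite card_dyad natrM -subn1 natrB//.
  have nn : 0 <= (n%:R : R) * (n%:R - 2) by rewrite mulr_ge0// subr_ge0 ler_nat.
  lra.
have -> : C * (Num.sqrt n%:R * fine g2) + e =
    C * Num.sqrt n%:R * (fine g2 + e' + e').
  by rewrite /e'; field; rewrite !gt_eqF.
have G0 : 0 <= 140 * Num.sqrt n%:R * (fine g2 + e' + e').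
  apply: mulr_ge0; last by rewrite !addr_ge0 ?(ltW e'0)// fine_ge0.
  by apply: mulr_ge0; [rewrite ler0n|exact: ltW].
have := ler_wpM2l G0 sNn; rewrite CE; lra.
Qed.
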